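(* Let $d$ and $i$ be integers with $2 < i < d-1$, and let $G$ be a graph that is generically redundantly rigid in $\mathbb{R}^d$ and $(d+1)$-connected. Then the graph attachment \[C_{2,\,i,\,2d-2-i,\,d-1} \lhd G\] (for any choice of the $d+1$ distinct attaching vertices of $G$) is generically almost-globally rigid in $\mathbb{R}^d$.
   Context: All graphs are finite, undirected and simple. For positive integers $x_1,x_2,x_3,x_4$, the 4-chain $C_{x_1,x_2,x_3,x_4}$ is the graph whose vertex set is the disjoint union of four independent sets $X_1,X_2,X_3,X_4$ with $|X_j|=x_j$, and whose edges are exactly all pairs with one vertex in $X_j$ and the other in $X_{j+1}$, for $j=1,2,3$. The attachment $C_{x_1,x_2,x_3,x_4}\lhd G$ is the graph obtained from the disjoint union of $C_{x_1,x_2,x_3,x_4}$ and $G$ by identifying the $x_1+x_4$ vertices of $X_1\cup X_4$ one-to-one with $x_1+x_4$ distinct vertices of $G$. A graph is $k$-connected if deleting any subset of $k-1$ vertices (and the edges incident to them) leaves a connected graph. A $d$-dimensional framework $(G,p)$ is a graph $G=(V,E)$ with a configuration $p:V\to\mathbb{R}^d$, $v_i\mapsto p_i$, where not all vertices lie on a hyperplane. Frameworks $(G,p)$ and $(G,q)$ are equivalent if $\|p_i-p_j\|=\|q_i-q_j\|$ for all adjacent $v_i,v_j$, and congruent if this holds for all pairs $v_i,v_j$. A framework is generic if the coordinates of its vertices are algebraically independent over $\mathbb{Z}$. A framework $(G,p)$ is globally rigid if every equivalent framework $(G,q)$ is congruent to it. It is locally flexible if there is a parametric (continuous) curve in $\mathbb{R}^{|V|d}$,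 starting at $p$, of configurations equivalent to $p$ that is not a Euclidean motion (i.e. not all configurations on it are congruent to $p$); otherwise it is locally rigid. A graph is generically locally (resp. globally) rigid in $\mathbb{R}^d$ if every generic $d$-dimensional framework of it is locally (resp. globally) rigid. A graph is generically redundantly rigid in $\mathbb{R}^d$ if deleting any single edge leaves a generically locally rigid graph. A graph is generically almost-globally rigid in $\mathbb{R}^d$ if it is a counterexample in $\mathbb{R}^d$ to Hendrickson's conjecture: it is non-complete, $(d+1)$-connected and generically redundantly rigid in $\mathbb{R}^d$, but not generically globally rigid in $\mathbb{R}^d$. *)

(* Defs.v *)
From HB Require Import structures.
From mathcomp Require Import all_boot all_order all_algebra.
From mathcomp Require Import all_classical all_reals all_analysis.
(* Only the structure instances: the notations clash with MathComp-Analysis. *)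
From mathcomp Require Import (canonicals) mpoly.

Set Implicit Arguments.
Unset Strict Implicit.
Unset Printing Implicit Defensive.

Import Order.TTheory GRing.Theory Num.Theory.
Import numFieldNormedType.Exports.

Local Open Scope classical_set_scope.
Local Open Scope ring_scope.

Record sgraph (V : finType) := SGraph {
  adj : rel V;
  adj_sym : symmetric adj;
  adj_irrefl : irreflexive adj
}.

Definition graph_complete (V : finType) (G : sgraph V) : Prop :=
  forall u v : V, u != v -> adj G u v.

Definition graph_connected (V : finType) (G : sgraph V) : Prop :=
  forall u v : V, connect (adj G) u v.

Section Deletion.
Variables (V : finType) (G : sgraph V).

Definition del_verts_rel (S : {set V}) : rel {v : V | v \notin S} :=
  fun u v => adj G (val u) (val v).

Lemma del_verts_sym S : symmetric (@del_verts_rel S).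
Proof. by move=> u v; exact: adj_sym. Qed.

Lemma del_verts_irrefl S : irreflexive (@del_verts_rel S).
Proof. by move=> u; exact: adj_irrefl. Qed.

Definition del_verts (S : {set V}) : sgraph {v : V | v \notin S} :=
  SGraph (@del_verts_sym S) (@del_verts_irrefl S).

Definition del_edge_rel (a b : V) : rel V :=
  fun u v => adj G u v && ([set u; v]%SET != [set a; b]%SET).

Lemma del_edge_sym a b : symmetric (del_edge_rel a b).
Proof. by move=> u v; rewrite /del_edge_rel adj_sym finset.setUC. Qed.

Lemma del_edge_irrefl a b : irreflexive (del_edge_rel a b).
Proof. by move=> u; rewrite /del_edge_rel adj_irrefl. Qed.

Definition del_edge (a b : V) : sgraph V :=
  SGraph (@del_edge_sym a b) (@del_edge_irrefl a b).

End Deletion.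

Definition k_connected (k : nat) (V : finType) (G : sgraph V) : Prop :=
  forall S : {set V}, #|S| = k.-1 -> graph_connected (del_verts G S).

(* The end parts X1, X4 of a 4-chain are grouped on the left, and the middle
   parts X2, X3 on the right. *)
Section FourChain.
Variables x1 x2 x3 x4 : nat.

Definition chain_vertex : finType :=
  (('I_x1 + 'I_x4) + ('I_x2 + 'I_x3))%type.

Definition chain_part (c : chain_vertex) : nat :=
  match c with
  | inl (inl _) => 1%N
  | inr (inl _) => 2%N
  | inr (inr _) => 3%N
  | inl (inr _) => 4%N
  end.

Definition chain_rel : rel chain_vertex := fun c c' =>
  (chain_part c' == (chain_part c).+1) || (chain_part c == (chain_part c').+1).

Lemma chain_sym : symmetric chain_rel.
Proof. by move=> c c'; rewrite /chain_rel orbC. Qed.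

Lemma chain_irrefl : irreflexive chain_rel.
Proof. by move=> c; rewrite /chain_rel orbb; elim: (chain_part c). Qed.

Definition four_chain : sgraph chain_vertex := SGraph chain_sym chain_irrefl.

(* The attachment along a : X1 + X4 -> V(G) is the quotient of the disjoint
   union of the chain and G; its vertices are those of G together with X2 and
   X3, and its edges are the images of the edges of the chain and of G. *)
Variables (V : finType) (G : sgraph V) (a : 'I_x1 + 'I_x4 -> V).

Definition attach_vertex : finType := (V + ('I_x2 + 'I_x3))%type.

Definition chain_to_attach (c : chain_vertex) : attach_vertex :=
  match c with
  | inl b => inl (a b)
  | inr m => inr m
  end.

Definition attach_rel : rel attach_vertex := fun u w =>
  [exists g : V, exists h : V, [&& adj G g h, inl g == u & inl h == w]] ||
  [exists c : chain_vertex, exists c' : chain_vertex,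
     [&& adj four_chain c c', chain_to_attach c == u & chain_to_attach c' == w]].

Lemma attach_sym : symmetric attach_rel.
Proof.
move=> u w; rewrite /attach_rel; congr (_ || _).
  by apply/existsP/existsP => -[g /existsP[h /and3P[gh gu hw]]];
    exists h; apply/existsP; exists g; rewrite adj_sym gh gu hw.
by apply/existsP/existsP => -[g /existsP[h /and3P[gh gu hw]]];
  exists h; apply/existsP; exists g; rewrite adj_sym gh gu hw.
Qed.

Lemma attach_irrefl : irreflexive attach_rel.
Proof.
move=> u; apply/negbTE/negP => /orP[] /existsP[g] /existsP[h] /and3P[].
  by move=> gh /eqP gu; rewrite -gu => /eqP[hg]; move: gh; rewrite hg adj_irrefl.
move=> gh /eqP <-.
by case: g gh => [[?|?]|[?|?]]; case: h => [[?|?]|[?|?]] // gh /eqP.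
Qed.

Definition attachment : sgraph attach_vertex :=
  SGraph attach_sym attach_irrefl.

End FourChain.

Section Frameworks.
Variables (R : realType) (d : nat).

Definition eucl_dist (x y : 'rV[R]_d) : R :=
  Num.sqrt (\sum_(k < d) (x ord0 k - y ord0 k) ^+ 2).

Section Config.
Variable V : finType.
Implicit Types (G : sgraph V) (p q : V -> 'rV[R]_d).

Definition on_hyperplane p : Prop :=
  exists (n : 'rV[R]_d) (c : R), n != 0 /\
    forall v : V, \sum_(k < d) n ord0 k * p v ord0 k = c.

Definition framework p : Prop := ~ on_hyperplane p.

Definition equivalent G p q : Prop :=
  forall u v : V, adj G u v -> eucl_dist (p u) (p v) = eucl_dist (q u) (q v).

Definition congruent p q : Prop :=
  forall u v : V, eucl_dist (p u) (p v) = eucl_dist (q u) (q v).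

Definition alg_independent (I : finType) (x : I -> R) : Prop :=
  forall P : mpoly.mpoly #|I| int, P != 0 ->
    mpoly.mmap (intr : int -> R) (fun j => x (enum_val j)) P != 0.

Definition generic p : Prop :=
  alg_independent (fun vk : V * 'I_d => p vk.1 ord0 vk.2).

Definition globally_rigid G p : Prop :=
  forall q, framework q -> equivalent G p q -> congruent p q.

(* Continuity into the finite product R^(|V| d) is continuity at every vertex. *)
Definition locally_flexible G p : Prop :=
  exists gamma : R -> V -> 'rV[R]_d,
    [/\ forall v, {within `[0, 1], continuous (fun t : R => gamma t v)},
        gamma 0 = p,
        forall t : R, t \in `[0, 1] -> equivalent G p (gamma t) &
        exists2 t : R, t \in `[0, 1] & ~ congruent p (gamma t)].

Definition locally_rigid G p : Prop := ~ locally_flexible G p.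

Definition generically_locally_rigid G : Prop :=
  forall p, framework p -> generic p -> locally_rigid G p.

Definition generically_globally_rigid G : Prop :=
  forall p, framework p -> generic p -> globally_rigid G p.

(* Local rigidity of G itself follows from that of any G - e, so the first
   conjunct only serves to exclude edgeless graphs, for which the second one
   is vacuous. *)
Definition generically_redundantly_rigid G : Prop :=
  generically_locally_rigid G /\
  forall a b : V, adj G a b -> generically_locally_rigid (del_edge G a b).

Definition generically_almost_globally_rigid G : Prop :=
  [/\ ~ graph_complete G,
      k_connected d.+1 G,
      generically_redundantly_rigid G &
      ~ generically_globally_rigid G].

End Config.
End Frameworks.

Arguments generically_locally_rigid R d {V} G.
Arguments generically_globally_rigid R d {V} G.
Arguments generically_redundantly_rigid R d {V} G.
Arguments generically_almost_globally_rigid R d {V} G.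

(* Main.v *)
From HB Require Import structures.
Require Import Defs.
From mathcomp Require Import all_boot all_order all_algebra.
From mathcomp Require Import all_classical all_reals all_analysis.
From mathcomp Require Import (canonicals, coercions) mpoly.
From mathcomp Require Import perm zify ring lra.
Set Implicit Arguments.
Unset Strict Implicit.
Unset Printing Implicit Defensive.
Import Order.TTheory GRing.Theory Num.Theory.
Import numFieldNormedType.Exports.
Local Open Scope classical_set_scope.
Local Open Scope ring_scope.

(** Write X1, ..., X4 for the parts of the chain, X1 and X4 being made of vertices
    of G, and H for the attachment. For a configuration in general position the
    d + 1 points of X1 + X4 form a simplex. Let beta_j (for j in X1) and gamma_k
    (for k in X4) be the barycentric coordinates with respect to it. Everything
    rests on a coincidence of dimensions: the quadrics sum_jk c_jk beta_j gamma_k,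
    which contain the line of X1 and the flat of X4, form a space of dimension
    2 (d - 1), and this is also the number of points in X2 + X3.

    Generic configurations. A polynomial with integer coefficients that does not
    vanish somewhere vanishes at no generic configuration. So d + 1 vertices are
    always affinely independent, and, as the space of quadrics and the set of
    points have the same size, no nonzero quadric of the family passes through
    all points of X2 + X3 ([generic_quadric_eq0]). Generic configurations exist in
    every box, because there are only countably many polynomials to avoid.

    Redundant rigidity. A motion of H moves G rigidly, if necessary without the
    deleted edge; after alignment G is pinned. A velocity v at a vertex s is
    encoded by the affine function t |-> (s - t).v. The edge conditions then force
    the flexes of the pinned chain to come from a quadric of the family through
    all points of X2 + X3, so there are none. The inequalities 2 < i < d - 1 leave
    one spare vertex on each side of the bipartite chain, and the argument
    survives the loss of any one edge ([pinned_flex_eq0]). Infinitesimal rigidity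
    implies that the pinned position is isolated among the equivalent ones, and a
    continuous motion cannot leave an isolated position
    ([attachment_locally_rigid]).

    Connectivity is a count, except that the hypothesis on the connectivity of G
    says nothing if G has only d + 1 vertices; but then rigidity makes G complete
    ([rigid_simplex_complete]).

    Failure of global rigidity. Let S be an affine map that fixes the flat of X4,
    and T the affine map that fixes the line of X1 and whose linear part is the
    inverse transpose of that of S. Then |S y - T z|^2 - |y - z|^2 is the sum of a
    function of y and a function of z. Moving X2 by S and X3 by T, and keeping G,
    gives an equivalent framework as soon as one equation per point of X2 + X3
    holds: 2 (d - 1) equations for S, which has 2 (d - 1) parameters c
    ([moved_config_equivalent]). The solution c = 0 is trivial, and the linear part
    of the system is the matrix of values of the products beta_j gamma_k. At a
    special configuration where this matrix has a kernel of dimension 1, a branch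
    of nontrivial solutions leaves the trivial one transversally. Writing
    c = s zeta, with one entry of zeta equal to 1, and dividing by s, one gets a
    system that can be solved by contraction for all configurations nearby
    ([perturbed_system_solution]). For a generic configuration s is nonzero,
    because no quadric of the family passes through X2 + X3, and so the new
    framework is not congruent to the old one. *)

(** * Generic points *)

Section EvalLast.
Variables (R : realType) (n : nat) (x : 'I_n.+1 -> R).

Let mpeval k (y : 'I_k -> R) : mpoly.mpoly k int -> R :=
  mpoly.mmap (intr : int -> R) y.
Let widen_pt : 'I_n -> R := fun j => x (widen_ord (leqnSn n) j).
Let truncm (m : mpoly.multinom n.+1) : mpoly.multinom n :=
  mpoly.Multinom [tuple m (widen_ord (leqnSn n) i) | i < n].

Lemma mpeval_muni (P : mpoly.mpoly n.+1 int) :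
  mpeval x P = (map_poly (mpeval widen_pt) (mpoly.muni P)).[x ord_max].
Proof.
rewrite /mpeval mpoly.muniE rmorph_sum horner_sum {1}/mpoly.mmap.
apply: eq_bigr => m _.
rewrite /= map_polyZ map_polyXn hornerZ hornerXn /=.
rewrite mpoly.mmapZ /= mpoly.mmapX /mpoly.mmap1 big_ord_recr /= mulrA.
congr (_ * _ * _); apply: eq_bigr => j _.
by rewrite mpoly.mnmE.
Qed.

(** The coefficient of a monomial of P is a coefficient of the polynomial that
    muni P has at the last exponent of this monomial. *)
Lemma muni_neq0 (P : mpoly.mpoly n.+1 int) : P != 0 -> mpoly.muni P != 0.
Proof.
rewrite -mpoly.msupp_eq0; case E : (mpoly.msupp P) => [//|m0 s] _.
have m0P : m0 \in mpoly.msupp P by rewrite E inE eqxx.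
apply: contraTneq m0P => P0.
have : mpoly.mcoeff (truncm m0) (mpoly.muni P)`_(m0 ord_max) = 0.
  by rewrite P0 coef0 mpoly.mcoeff0.
rewrite mpoly.muniE coef_sum raddf_sum /=.
under eq_bigr => m _ do
  rewrite coefZ coefXn mulr_natr mpoly.mcoeffMn mpoly.mcoeffZ mpoly.mcoeffX.
move=> H; rewrite mpoly.mcoeff_msupp negbK; move: H.
case: (boolP (m0 \in mpoly.msupp P)) => [m0P|/mpoly.memN_msupp_eq0 -> //].
rewrite (bigD1_seq m0 m0P (mpoly.msupp_uniq P)) /=.
rewrite !eqxx /= mulr1n mulr1 big1 ?addr0 => [->//|m mm0].
case: (eqVneq (m0 ord_max) (m ord_max)) => //= em.
case: eqVneq => [tm|]; last by rewrite mulr0.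
case/eqP: mm0; apply/mpoly.mnmP => j.
case: (unliftP ord_max j) => [k ->|-> //].
have /(_ k) := (mpoly.mnmP _ _).1 tm; rewrite !mpoly.mnmE.
by rewrite (_ : widen_ord _ k = lift ord_max k) //; apply/val_inj; rewrite /= /bump leqNgt ltn_ord.
Qed.

End EvalLast.

Lemma finite_roots (R : realType) (q : {poly R}) :
  q != 0 -> finite_set [set t | root q t].
Proof.
have [n] := ubnP (size q); elim: n q => // n IH q szq q0.
have [[a ra]|nor] := pselect (exists a, root q a); last first.
  rewrite (_ : [set t | _] = set0) //.
  by apply/seteqP; split => // t /= rt; apply: nor; exists t.
have /factor_theorem[r qE] := ra.
have r0 : r != 0 by apply: contraNneq q0 => r0; rewrite qE r0 mul0r.
apply: (@sub_finite_set _ _ ([set a] `|` [set t | root r t])).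
  move=> t /=; rewrite qE rootM root_XsubC => /orP[|/eqP]; by [right|left].
rewrite finite_setU; split; first exact: finite_set1.
apply: IH => //; move: szq; rewrite qE size_Mmonic ?monicXsubC //.
by rewrite size_XsubC addn2.
Qed.

(** Countable sets are Lebesgue-null, and intervals are not. *)
Lemma countable_interval_gap (R : realType) (A : set R) (c e : R) :
  countable A -> 0 < e -> exists2 t, `|t - c| < e & ~ A t.
Proof.
move=> cA e0; apply: contrapT => nex.
have sub : `](c - e), (c + e)[ `<=` A.
  move=> t /=; rewrite in_itv /= -ltr_distl => tc.
  by apply: contrapT => nAt; apply: nex; exists t.
have := countable_lebesgue_measure0 (sub_countable (subset_card_le sub) cA).
rewrite lebesgue_measure_itv /= lte_fin ltrBlDr -addrA ltrDl addr_gt0 //.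
move/eqP; rewrite -EFinD eqe opprB addrC addrA subrK.
by rewrite (gt_eqF (addr_gt0 e0 e0)).
Qed.

(** The coordinates are chosen one after the other: once the first n of them are
    algebraically independent, every nonzero polynomial excludes only finitely
    many values of the last one, and there are countably many polynomials. *)
Lemma exists_indep_tuple (R : realType) n (c : 'I_n -> R) (e : R) : 0 < e ->
  exists2 x : 'I_n -> R, (forall j, `|x j - c j| < e) &
    forall P : mpoly.mpoly n int, P != 0 -> mpoly.mmap (intr : int -> R) x P != 0.
Proof.
move=> e0; elim: n c => [|n IH] c.
  exists (fun=> 0) => [[]//|P P0].
  have PE : P = mpoly.mpolyC 0 (mpoly.mcoeff mpoly.mnm0 P).
    apply/mpoly.mpolyP => m; rewrite mpoly.mcoeffC.
    have -> : m = mpoly.mnm0 by apply/mpoly.mnmP => -[].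
    by rewrite eqxx mulr1.
  move: P0; rewrite PE mpoly.mmapC intr_eq0; apply: contraNN => /eqP ->.
  by rewrite mpoly.mpolyC0.
have [y yc yP] := IH (fun j => c (widen_ord (leqnSn n) j)).
(* Every polynomial is coded by the list of its terms, of a countable type. *)
pose pol (s : seq (int * mpoly.multinom n.+1)) : mpoly.mpoly n.+1 int :=
  \sum_(u <- s) u.1 *: mpoly.mpolyX int u.2.
pose q (P : mpoly.mpoly n.+1 int) :=
  map_poly (mpoly.mmap (intr : int -> R) y) (mpoly.muni P).
pose bad s := [set t | pol s != 0 /\ root (q (pol s)) t].
have q0 P : P != 0 -> q P != 0.
  move=> /muni_neq0 P0; apply: contraNneq P0 => qP0; apply/eqP/polyP => k.
  have qk : mpoly.mmap (intr : int -> R) y (mpoly.muni P)`_k = 0.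
    by rewrite -[RHS](coef0 R k) -qP0 coef_map.
  rewrite coef0; apply/eqP; apply: contraT => /yP.
  by rewrite qk eqxx.
have cbad : countable (\bigcup_s bad s).
  apply: bigcup_countable => // s _; apply: finite_set_countable.
  have [p0|p0] := eqVneq (pol s) 0.
    rewrite (_ : bad s = set0) //.
    by apply/seteqP; split => // t [] /=; rewrite p0 eqxx.
  apply: sub_finite_set (finite_roots (q0 _ p0)).
  by move=> t [].
have [t tc nbad] := countable_interval_gap (c ord_max) cbad e0.
pose x (j : 'I_n.+1) := if unlift ord_max j is Some k then y k else t.
have xw j : x (widen_ord (leqnSn n) j) = y j.
  rewrite /x (_ : widen_ord _ j = lift ord_max j) ?liftK //.
  by apply/val_inj; rewrite /= /bump leqNgt ltn_ord.
exists x => [j|P P0].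
  rewrite /x; case: unliftP => [k ->|-> //].
  rewrite (_ : lift _ _ = widen_ord (leqnSn n) k) //.
  by apply/val_inj; rewrite /= /bump leqNgt ltn_ord.
rewrite mpeval_muni (_ : (fun j => _) = y); last exact/funext.
rewrite [x ord_max]/x unlift_none; apply/negP => /eqP r0; apply: nbad.
exists [seq (mpoly.mcoeff m P, m) | m <- mpoly.msupp P] => //.
rewrite /bad /= (_ : pol _ = P); first by split => //; rewrite /root /q r0.
by rewrite /pol big_map [RHS]mpoly.mpolyE.
Qed.

Section PolynomialFunctions.
Variables (R : realType) (I : finType).
Implicit Types (F G : (I -> R) -> R) (x : I -> R).

(** Integer polynomial functions are recognised by their closure properties, and a
    single point where such a function does not vanish is enough to know that it
    vanishes at no generic point. *)
Definition polyfun F : Prop :=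
  exists P : mpoly.mpoly #|I| int,
    forall x, F x = mpoly.mmap (intr : int -> R) (fun j => x (enum_val j)) P.

Lemma polyfun_eq F G : F =1 G -> polyfun F -> polyfun G.
Proof. by move=> FG [P PE]; exists P => x; rewrite -FG PE. Qed.

Lemma polyfun_int (c : int) : polyfun (fun=> c%:~R).
Proof. by exists (mpoly.mpolyC _ c) => x; rewrite mpoly.mmapC. Qed.

Lemma polyfun0 : polyfun (fun=> 0).
Proof. exact: (polyfun_int 0). Qed.

Lemma polyfun1 : polyfun (fun=> 1).
Proof. exact: (polyfun_int 1). Qed.

Lemma polyfun_var i : polyfun (fun x => x i).
Proof.
exists (mpoly.mpolyX int (mpoly.mnm1 (enum_rank i))) => x.
by rewrite mpoly.mmapX mpoly.mmap1U enum_rankK.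
Qed.

Lemma polyfunD F G : polyfun F -> polyfun G -> polyfun (fun x => F x + G x).
Proof. by move=> [P PE] [Q QE]; exists (P + Q) => x; rewrite raddfD PE QE. Qed.

Lemma polyfunM F G : polyfun F -> polyfun G -> polyfun (fun x => F x * G x).
Proof. by move=> [P PE] [Q QE]; exists (P * Q) => x; rewrite rmorphM PE QE. Qed.

Lemma polyfun_sum (J : Type) (r : seq J) (Q : pred J) (F : J -> (I -> R) -> R) :
  (forall j, polyfun (F j)) -> polyfun (fun x => \sum_(j <- r | Q j) F j x).
Proof.
move=> pF; elim: r => [|j r IH].
  by apply: polyfun_eq polyfun0 => x; rewrite big_nil.
have [Qj|/negbTE Qj] := boolP (Q j).
  by apply: polyfun_eq (polyfunD (pF j) IH) => x; rewrite big_cons Qj.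
by apply: polyfun_eq IH => x; rewrite big_cons Qj.
Qed.

Lemma polyfun_prod (J : Type) (r : seq J) (Q : pred J) (F : J -> (I -> R) -> R) :
  (forall j, polyfun (F j)) -> polyfun (fun x => \prod_(j <- r | Q j) F j x).
Proof.
move=> pF; elim: r => [|j r IH].
  by apply: polyfun_eq polyfun1 => x; rewrite big_nil.
have [Qj|/negbTE Qj] := boolP (Q j).
  by apply: polyfun_eq (polyfunM (pF j) IH) => x; rewrite big_cons Qj.
by apply: polyfun_eq IH => x; rewrite big_cons Qj.
Qed.

Lemma polyfun_sign n : polyfun (fun=> (-1) ^+ n).
Proof.
by apply: polyfun_eq (polyfun_int ((-1) ^+ n)) => x; rewrite rmorphXn rmorphN1.
Qed.

Definition polymx m n (A : (I -> R) -> 'M[R]_(m, n)) : Prop :=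
  forall i j, polyfun (fun x => A x i j).

Lemma polyfun_det n (A : (I -> R) -> 'M[R]_n) :
  polymx A -> polyfun (fun x => \det (A x)).
Proof.
move=> pA; apply: polyfun_sum => s; apply: polyfunM; first exact: polyfun_sign.
by apply: polyfun_prod => i; apply: pA.
Qed.

Lemma polymx_adj n (A : (I -> R) -> 'M[R]_n) :
  polymx A -> polymx (fun x => \adj (A x)).
Proof.
move=> pA i j.
apply: (@polyfun_eq (fun x => (-1) ^+ (j + i) * \det (row' j (col' i (A x))))).
  by move=> x; rewrite mxE.
apply: polyfunM; first exact: polyfun_sign.
apply: polyfun_det => k l.
apply: (@polyfun_eq (fun x => A x (lift j k) (lift i l))) => [x|].
  by rewrite !mxE.
exact: pA.
Qed.

Lemma polymx_mul m n k (A : (I -> R) -> 'M[R]_(m, n)) (B : (I -> R) -> 'M[R]_(n, k)) :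
  polymx A -> polymx B -> polymx (fun x => A x *m B x).
Proof.
move=> pA pB i j.
apply: (@polyfun_eq (fun x => \sum_l A x i l * B x l j)) => [x|].
  by rewrite mxE.
by apply: polyfun_sum => l; apply: polyfunM.
Qed.

Lemma alg_independent_neq0 x F x0 :
  alg_independent x -> polyfun F -> F x0 != 0 -> F x != 0.
Proof.
move=> xI [P PE]; rewrite !PE => Px0; apply: xI.
by apply: contraNneq Px0 => ->; rewrite raddf0.
Qed.

Lemma exists_alg_independent (c : I -> R) (e : R) : 0 < e ->
  exists2 x : I -> R, (forall i, `|x i - c i| < e) & alg_independent x.
Proof.
move=> e0; have [y yc yP] := exists_indep_tuple (fun j : 'I_#|I| => c (enum_val j)) e0.
exists (fun i => y (enum_rank i)) => [i|P P0].
  by have := yc (enum_rank i); rewrite enum_rankK.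
rewrite (_ : (fun j => _) = y); first exact: yP.
by apply/funext => j; rewrite enum_valK.
Qed.

End PolynomialFunctions.

(** A nonzero polynomial in some of the variables does not vanish at an
    independent tuple, hence it is not the zero function of all the variables. *)
Lemma alg_independent_comp (R : realType) (I J : finType) (f : J -> I) (x : I -> R) :
  injective f -> alg_independent x -> alg_independent (x \o f).
Proof.
move=> finj xI P P0.
pose F (z : I -> R) :=
  mpoly.mmap (intr : int -> R) (fun j => z (f (enum_val j))) P.
have pF : polyfun F.
  apply: polyfun_sum => m; apply: polyfunM; first exact: polyfun_int.
  apply: polyfun_prod => k.
  elim: (mpoly.fun_of_multinom m k) => [|n IH]; first exact: polyfun1.
  apply: (@polyfun_eq _ _ (fun z => z (f (enum_val k)) * z (f (enum_val k)) ^+ n)).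
    by move=> z; rewrite exprS.
  by apply: polyfunM => //; exact: polyfun_var.
have [y _ yI] := exists_alg_independent (fun _ : J => 0 : R) ltr01.
pose z0 (i : I) := if [pick j | f j == i] is Some j then y j else 0.
apply: (alg_independent_neq0 (x0 := z0) xI pF).
rewrite /F (_ : (fun j => _) = fun j => y (enum_val j)); first exact: yI.
apply/funext => j; rewrite /z0; case: pickP => [k /eqP/finj -> //|].
by move=> /(_ (enum_val j)); rewrite eqxx.
Qed.

(** * Affine functions and general position *)

Section AffineFunctions.
Variables (R : realType) (d : nat).
Implicit Types (s t u v : 'rV[R]_d) (f g : 'cV[R]_(1 + d)).

(** Homogeneous coordinates: columns act on them as affine functions. *)
Definition hat s : 'rV[R]_(1 + d) := row_mx (const_mx 1) s.

Definition affine f s : R := (hat s *m f) 0 0.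

Definition gradient f : 'rV[R]_d := (dsubmx f)^T.

Definition dot u v : R := \sum_(k < d) u 0 k * v 0 k.

Lemma dotC u v : dot u v = dot v u.
Proof. by apply: eq_bigr => k _; rewrite mulrC. Qed.

Lemma dotDl u v w : dot (u + v) w = dot u w + dot v w.
Proof. by rewrite -big_split; apply: eq_bigr => k _; rewrite !mxE mulrDl. Qed.

Lemma dotZl c u w : dot (c *: u) w = c * dot u w.
Proof. by rewrite mulr_sumr; apply: eq_bigr => k _; rewrite !mxE mulrA. Qed.

Lemma dotNl u w : dot (- u) w = - dot u w.
Proof. by rewrite -scaleN1r dotZl mulN1r. Qed.

Lemma dotBl u v w : dot (u - v) w = dot u w - dot v w.
Proof. by rewrite dotDl dotNl. Qed.

Lemma dotDr u v w : dot w (u + v) = dot w u + dot w v.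
Proof. by rewrite !(dotC w) dotDl. Qed.

Lemma dotZr c u w : dot w (c *: u) = c * dot w u.
Proof. by rewrite !(dotC w) dotZl. Qed.

Lemma dotNr u w : dot w (- u) = - dot w u.
Proof. by rewrite !(dotC w) dotNl. Qed.

Lemma dotBr u v w : dot w (u - v) = dot w u - dot w v.
Proof. by rewrite dotDr dotNr. Qed.

Lemma dot0l u : dot 0 u = 0.
Proof. by rewrite -(scale0r 0) dotZl mul0r. Qed.

Lemma dot_suml (J : finType) (F : J -> 'rV[R]_d) u :
  dot (\sum_j F j) u = \sum_j dot (F j) u.
Proof.
by rewrite (big_morph (fun v => dot v u) (fun v w => dotDl v w u) (dot0l u)).
Qed.

Lemma dot_sumr (J : finType) (F : J -> 'rV[R]_d) u :
  dot u (\sum_j F j) = \sum_j dot u (F j).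
Proof. by rewrite dotC dot_suml; apply: eq_bigr => j _; rewrite dotC. Qed.

Lemma dot_ge0 u : 0 <= dot u u.
Proof. by apply: sumr_ge0 => k _; rewrite -expr2 sqr_ge0. Qed.

Lemma dot_eq0 u : (dot u u == 0) = (u == 0).
Proof.
apply/idP/eqP => [|->]; last by rewrite dot0l.
rewrite /dot psumr_eq0 => [/allP u0|k _]; last by rewrite -expr2 sqr_ge0.
apply/rowP => k; rewrite mxE; apply/eqP.
by have := u0 k (mem_index_enum k); rewrite /= mulf_eq0 orbb.
Qed.

Lemma dot_eq0_all v : (forall u, dot u v = 0) -> v = 0.
Proof. by move=> v0; apply/eqP; rewrite -dot_eq0 v0. Qed.

Lemma eucl_distE s t : eucl_dist s t = Num.sqrt (dot (s - t) (s - t)).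
Proof.
by congr Num.sqrt; apply: eq_bigr => k _; rewrite !mxE expr2.
Qed.

Lemma eucl_dist_eqP s t u v : eucl_dist s t = eucl_dist u v <->
  dot (s - t) (s - t) = dot (u - v) (u - v).
Proof.
rewrite !eucl_distE; split => [/eqP|-> //].
by rewrite eqr_sqrt ?dot_ge0 // => /eqP.
Qed.

Lemma affineE f s : affine f s = f (lshift d ord0) 0 + dot s (gradient f).
Proof.
rewrite /affine mxE big_split_ord /= big_ord1 /hat row_mxEl mxE mul1r.
by congr (_ + _); apply: eq_bigr => k _; rewrite row_mxEr !mxE.
Qed.

Lemma affineB f s t : affine f s - affine f t = dot (s - t) (gradient f).
Proof. by rewrite !affineE dotBl opprD addrACA subrr add0r. Qed.

Lemma affineDf f g s : affine (f + g) s = affine f s + affine g s.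
Proof. by rewrite /affine mulmxDr mxE. Qed.

Lemma affineZf c f s : affine (c *: f) s = c * affine f s.
Proof. by rewrite /affine -scalemxAr mxE. Qed.

Lemma affineNf f s : affine (- f) s = - affine f s.
Proof. by rewrite -scaleN1r affineZf mulN1r. Qed.

Lemma affine0f s : affine 0 s = 0.
Proof. by rewrite /affine mulmx0 mxE. Qed.

Lemma affine_sumf (J : finType) (F : J -> 'cV[R]_(1 + d)) s :
  affine (\sum_j F j) s = \sum_j affine (F j) s.
Proof. by rewrite /affine mulmx_sumr summxE. Qed.

(** The affine function t |-> (s - t).v encodes a velocity v at the point s: the
    first-order condition along an edge st only involves the values at t and s of
    the functions of s and t. *)
Definition affine_at s v : 'cV[R]_(1 + d) := col_mx (dot s v)%:M (- v^T).

Lemma affine_atE s v t : affine (affine_at s v) t = dot (s - t) v.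
Proof.
rewrite affineE /affine_at col_mxEu mxE mulr1n /gradient col_mxKd.
by rewrite linearN /= trmxK dotNr dotBl.
Qed.

Lemma affine_at_inj s v : affine_at s v = 0 -> v = 0.
Proof.
move=> av0; apply: dot_eq0_all => u.
by have := affine_atE s v (s - u); rewrite av0 affine0f opprB addrC subrK.
Qed.

Definition hatmx (P : 'I_(1 + d) -> 'rV[R]_d) : 'M[R]_(1 + d) :=
  \matrix_k hat (P k).

Lemma affine_eq0 P f :
  hatmx P \in unitmx -> (forall k, affine f (P k) = 0) -> f = 0.
Proof.
move=> uP f0; rewrite -[f](mulKmx uP) (_ : hatmx P *m f = 0) ?mulmx0 //.
apply/colP => k; rewrite [RHS]mxE -(f0 k) /affine !mxE.
by apply: eq_bigr => j _; rewrite mxE.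
Qed.

Definition simplex (k : 'I_(1 + d)) : 'rV[R]_d :=
  match fintype.split k with inl _ => 0 | inr j => delta_mx 0 j end.

Lemma det_simplex : \det (hatmx simplex) = 1.
Proof.
rewrite (_ : hatmx _ = block_mx 1%:M 0 (const_mx 1) 1%:M).
  by rewrite det_lblock !det1 mulr1.
apply/matrixP => k j; rewrite mxE.
rewrite /hat /simplex; case: (split_ordP k) => k' ->; case: (split_ordP j) => j' ->.
- by rewrite row_mxEl block_mxEul !mxE !ord1.
- by rewrite row_mxEr block_mxEur !mxE.
- by rewrite row_mxEl block_mxEdl !mxE.
- by rewrite row_mxEr block_mxEdr !mxE eq_sym.
Qed.

End AffineFunctions.

Section GenericPosition.
Variables (R : realType) (d : nat) (U : finType).
Implicit Types (x : U * 'I_d -> R) (p : U -> 'rV[R]_d) (f : 'cV[R]_(1 + d)).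

Definition config_of x : U -> 'rV[R]_d := fun u => \row_k x (u, k).

Definition coords p : U * 'I_d -> R := fun uk => p uk.1 ord0 uk.2.

Lemma coordsK p : config_of (coords p) = p.
Proof. by apply/funext => u; apply/rowP => k; rewrite mxE. Qed.

Lemma config_ofK x : coords (config_of x) = x.
Proof. by apply/funext => -[u k]; rewrite /coords mxE. Qed.

Lemma polymx_hat u : polymx (fun x => hat (config_of x u)).
Proof.
move=> i j; case: (split_ordP j) => j' ->.
  by apply: polyfun_eq (polyfun1 _ _) => x; rewrite /hat row_mxEl mxE.
apply: polyfun_eq (polyfun_var _ (u, j')) => x.
by rewrite /hat row_mxEr mxE.
Qed.

Lemma polymx_hatmx (e : 'I_(1 + d) -> U) :
  polymx (fun x => hatmx (fun k => config_of x (e k))).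
Proof.
move=> i j; apply: polyfun_eq (polymx_hat (e i) ord0 j) => x.
by rewrite !mxE.
Qed.

Lemma generic_neq0 p F x0 :
  generic p -> polyfun F -> F x0 != 0 -> F (coords p) != 0.
Proof. exact: alg_independent_neq0. Qed.

(** The determinant is 1 if the chosen vertices are those of a standard
    simplex. *)
Lemma generic_hatmx p (e : 'I_(1 + d) -> U) :
  generic p -> injective e -> hatmx (fun k => p (e k)) \in unitmx.
Proof.
move=> gp einj; rewrite unitmxE unitfE.
pose F x := \det (hatmx (fun k => config_of x (e k))).
suff : F (coords p) != 0 by rewrite /F coordsK.
pose q u := if [pick k | e k == u] is Some k then simplex R k else 0.
apply: (generic_neq0 (x0 := coords q) gp); first exact/polyfun_det/polymx_hatmx.
rewrite /F coordsK (_ : hatmx _ = hatmx (@simplex R d)) ?det_simplex ?oner_neq0 //.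
apply/matrixP => k j; rewrite !mxE /q; case: pickP => [l /eqP/einj -> //|].
by move=> /(_ k); rewrite eqxx.
Qed.

Lemma generic_affine_eq0 p (S : {set U}) f :
  generic p -> (d < #|S|)%N -> (forall u, u \in S -> affine f (p u) = 0) -> f = 0.
Proof.
move=> gp dS fS; pose e (k : 'I_(1 + d)) : U := enum_val (widen_ord dS k).
have einj : injective e by move=> k l /enum_val_inj [] /ord_inj.
by apply: (affine_eq0 (generic_hatmx gp einj)) => k; apply/fS/enum_valP.
Qed.

Lemma framework_of_unit (e : 'I_(1 + d) -> U) p :
  hatmx (fun k => p (e k)) \in unitmx -> framework p.
Proof.
move=> ue [n [c [n0 nc]]]; case/eqP: n0.
have f0 : col_mx (- c)%:M n^T = 0 :> 'cV[R]_(1 + d).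
  apply: (affine_eq0 ue) => k.
  rewrite affineE col_mxEu mxE mulr1n /gradient col_mxKd trmxK.
  by rewrite dotC -(nc (e k)) addNr.
have := congr1 (fun f => (dsubmx f)^T) f0.
by rewrite col_mxKd trmxK => ->; rewrite linear0 trmx0.
Qed.

Lemma generic_framework p : generic p -> (d < #|U|)%N -> framework p.
Proof.
move=> gp dU; pose e (k : 'I_(1 + d)) : U := enum_val (widen_ord dU k).
apply: (@framework_of_unit e); apply: generic_hatmx => //.
by move=> k l /enum_val_inj [] /ord_inj.
Qed.

Lemma generic_comp (W : finType) (h : W -> U) p :
  injective h -> generic p -> generic (p \o h).
Proof.
move=> hinj gp.
apply: (@alg_independent_comp R _ _ (fun wk : W * 'I_d => (h wk.1, wk.2)) _ _ gp).
by move=> [w k] [w' k'] [] /hinj -> ->.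
Qed.

Lemma exists_generic p (e : R) : 0 < e ->
  exists2 q : U -> 'rV[R]_d, forall u k, `|q u 0 k - p u 0 k| < e & generic q.
Proof.
move=> e0; have [x xp xI] := exists_alg_independent (coords p) e0.
exists (config_of x) => [u k|]; first by rewrite mxE; exact: (xp (u, k)).
by rewrite /generic -/(coords _) config_ofK.
Qed.

End GenericPosition.

Section Barycentric.
Variables (R : realType) (d : nat) (B : finType) (cardB : #|B| = (1 + d)%N).
Implicit Types (c : B -> 'rV[R]_d) (f : 'cV[R]_(1 + d)).

Definition anchor k : B := enum_val (cast_ord (esym cardB) k).

Definition anchor_rank b : 'I_(1 + d) := cast_ord cardB (enum_rank b).

Lemma anchorK : cancel anchor anchor_rank.
Proof. by move=> k; rewrite /anchor_rank /anchor enum_valK cast_ordKV. Qed.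

Lemma anchor_rankK : cancel anchor_rank anchor.
Proof. by move=> b; rewrite /anchor_rank /anchor cast_ordK enum_rankK. Qed.

Definition anchormx c : 'M[R]_(1 + d) := hatmx (fun k => c (anchor k)).

Definition bary c b : 'cV[R]_(1 + d) := col (anchor_rank b) (invmx (anchormx c)).

Lemma affine_bary c b s :
  affine (bary c b) s = (hat s *m invmx (anchormx c)) 0 (anchor_rank b).
Proof. by rewrite /affine /bary colE mulmxA -colE mxE. Qed.

Lemma affine_bary_adj c b s : anchormx c \in unitmx ->
  (hat s *m \adj (anchormx c)) 0 (anchor_rank b) =
  \det (anchormx c) * affine (bary c b) s.
Proof.
move=> uc; have d0 : \det (anchormx c) != 0 by rewrite -unitfE -unitmxE.
rewrite affine_bary /invmx uc -scalemxAr [in RHS]mxE mulrA mulfV ?mul1r //.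
Qed.

Variable c : B -> 'rV[R]_d.
Hypothesis uc : anchormx c \in unitmx.

Lemma bary_anchor b b' : affine (bary c b) (c b') = (b == b')%:R.
Proof.
rewrite affine_bary.
have -> : hat (c b') = row (anchor_rank b') (anchormx c).
  by rewrite rowK anchor_rankK.
by rewrite -row_mul mulmxV // !mxE (can_eq anchor_rankK) eq_sym.
Qed.

(** Both sides are affine and agree at the vertices of the simplex. *)
Lemma affine_baryE f s :
  affine f s = \sum_b affine f (c b) * affine (bary c b) s.
Proof.
suff /eqP : f - \sum_b affine f (c b) *: bary c b = 0.
  rewrite subr_eq0 => /eqP {1}->; rewrite affine_sumf.
  by apply: eq_bigr => b _; rewrite affineZf.
apply: (affine_eq0 uc) => k; rewrite affineDf affineNf affine_sumf.
rewrite (bigD1 (anchor k)) //= affineZf bary_anchor eqxx mulr1 big1 ?addr0 ?subrr //.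
by move=> b bk; rewrite affineZf bary_anchor (negbTE bk) mulr0.
Qed.

End Barycentric.

Section QuadricMatrix.
Variables (R : realType) (d : nat) (V N : finType).
Variables (n1 n2 : nat) (a : 'I_n1 + 'I_n2 -> V).
Hypothesis a_inj : injective a.
Hypothesis cardB : #|('I_n1 + 'I_n2 : finType)%type| = (1 + d)%N.
Hypothesis cardN : #|N| = (n1 * n2)%N.

Let B : finType := ('I_n1 + 'I_n2)%type.
Let U : finType := (V + N)%type.

Definition anchors (p : U -> 'rV[R]_d) : B -> 'rV[R]_d := fun b => p (inl (a b)).

Lemma generic_anchors p : generic p -> anchormx cardB (anchors p) \in unitmx.
Proof.
move=> gp; apply: (@generic_hatmx _ _ _ p (fun k => inl (a (anchor cardB k)))) => //.
by move=> k l [] /a_inj /(can_inj (anchorK cardB)).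
Qed.

(** Special configurations, which serve as witnesses that polynomial functions do
    not vanish: the anchors form a standard simplex and N is placed freely. *)
Definition simplex_config (h : N -> 'rV[R]_d) : U -> 'rV[R]_d := fun u =>
  match u with
  | inl v => if [pick b | a b == v] is Some b then simplex R (anchor_rank cardB b) else 0
  | inr n => h n
  end.

Lemma anchors_simplex h b :
  anchors (simplex_config h) b = simplex R (anchor_rank cardB b).
Proof.
rewrite /anchors /=; case: pickP => [b' /eqP/a_inj -> //|].
by move=> /(_ b); rewrite eqxx.
Qed.

Lemma anchormx_simplex h :
  anchormx cardB (anchors (simplex_config h)) = hatmx (@simplex R d).
Proof.
by apply/matrixP => k l; rewrite [LHS]mxE [RHS]mxE anchors_simplex anchorK.
Qed.

Lemma anchormx_simplex_unit h :
  anchormx cardB (anchors (simplex_config h)) \in unitmx.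
Proof. by rewrite anchormx_simplex unitmxE det_simplex unitr1. Qed.

Let bary' p b := bary cardB (anchors p) b.

Definition simplex_mid (b b' : B) : 'rV[R]_d :=
  2^-1 *: (simplex R (anchor_rank cardB b) + simplex R (anchor_rank cardB b')).

Lemma affine_simplex_mid h b b' f :
  affine f (simplex_mid b b') =
  2^-1 * (affine f (anchors (simplex_config h) b) +
          affine f (anchors (simplex_config h) b')).
Proof.
rewrite !anchors_simplex /simplex_mid !affineE dotZl dotDl.
lra.
Qed.

Lemma exists_pairing (n0 : N) (k0 : 'I_n1 * 'I_n2) :
  exists2 pr : N -> 'I_n1 * 'I_n2, bijective pr & pr n0 = k0.
Proof.
have cardE : #|N| = #|('I_n1 * 'I_n2 : finType)%type|.
  by rewrite card_prod !card_ord.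
pose pr0 n := enum_val (cast_ord cardE (enum_rank n)).
have pr0_bij : bijective pr0.
  exists (fun k => enum_val (cast_ord (esym cardE) (enum_rank k))) => n.
    by rewrite /pr0 enum_valK cast_ordK enum_rankK.
  by rewrite /pr0 enum_valK cast_ordKV enum_rankK.
exists (fun n => tperm (pr0 n0) k0 (pr0 n)); last by rewrite tpermL.
by apply: bij_comp pr0_bij; exists (tperm (pr0 n0) k0) => k; rewrite tpermK.
Qed.

(** The values of the n1 * n2 products of barycentric coordinates at the points of
    N form a square matrix. Pair these points with the products, and place the
    point that is paired with (j, k) halfway between the anchors j and k: all
    products but the one with index (j, k) vanish there, and the matrix is
    scalar. *)
Lemma generic_quadric_eq0 p (c : 'I_n1 -> 'I_n2 -> R) :
  generic p ->
  (forall n, \sum_j \sum_k c j k * affine (bary' p (inl j)) (p (inr n)) *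
     affine (bary' p (inr k)) (p (inr n)) = 0) ->
  forall j k, c j k = 0.
Proof.
move=> gp c0 j0 k0.
have [n0 _|N0] := pickP (mem N); last first.
  have n12 : (0 < n1 * n2)%N.
    by rewrite muln_gt0 (leq_trans _ (ltn_ord j0)) // (leq_trans _ (ltn_ord k0)).
  by move: n12; rewrite -cardN eq_card0.
have [pr prb _] := exists_pairing n0 (j0, k0).
pose H x n b := (hat (config_of x (inr n)) *m
  \adj (anchormx cardB (anchors (config_of x)))) 0 (anchor_rank cardB b).
pose Q x : 'M[R]_#|N| := \matrix_(r, s)
  (H x (enum_val r) (inl (pr (enum_val s)).1) *
   H x (enum_val r) (inr (pr (enum_val s)).2)).
have pH n b : polyfun (fun x => H x n b).
  apply: polymx_mul; first exact: polymx_hat.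
  exact/polymx_adj/polymx_hatmx.
have pF : polyfun (fun x => \det (Q x)).
  apply: polyfun_det => r s.
  apply: polyfun_eq (polyfunM (pH (enum_val r) _) (pH (enum_val r) _)) => x.
  by rewrite mxE.
pose h n := simplex_mid (inl (pr n).1) (inr (pr n).2).
have Q0 : \det (Q (coords (simplex_config h))) != 0.
  rewrite (_ : Q _ = (2^-1 * 2^-1)%:M).
    by rewrite det_scalar expf_neq0 // mulf_neq0 // invr_neq0 // pnatr_eq0.
  apply/matrixP => r s; rewrite mxE /H coordsK !affine_bary_adj ?anchormx_simplex_unit //.
  rewrite anchormx_simplex det_simplex !mul1r /=.
  rewrite !(affine_simplex_mid h) !bary_anchor ?anchormx_simplex_unit //=.
  rewrite mxE -(inj_eq enum_val_inj) -(inj_eq (bij_inj prb)).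
  case: (pr (enum_val r)) (pr (enum_val s)) => [j k] [j' k'].
  have ell (l l' : 'I_n1) : (inl l == inl l' :> B) = (l == l') by [].
  have err (l l' : 'I_n2) : (inr l == inr l' :> B) = (l == l') by [].
  have elr (l : 'I_n1) (l' : 'I_n2) : (inl l == inr l' :> B) = false by [].
  have erl (l : 'I_n1) (l' : 'I_n2) : (inr l' == inl l :> B) = false by [].
  rewrite xpair_eqE /= ?ell ?err ?elr ?erl addr0 add0r (eq_sym j) (eq_sym k).
  case: (j' == j); case: (k' == k); by rewrite /= ?(mulr0, mul0r, mulr1).
have := generic_neq0 gp pF Q0; rewrite -unitfE -unitmxE => uQ.
pose v : 'cV[R]_#|N| := \col_s c (pr (enum_val s)).1 (pr (enum_val s)).2.
have Qv : Q (coords p) *m v = 0.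
  apply/colP => r; rewrite !mxE.
  pose D := \det (anchormx cardB (anchors p)).
  have c0r := congr1 (fun z => D * D * z) (c0 (enum_val r)).
  rewrite mulr0 in c0r; rewrite -[RHS]c0r.
  rewrite pair_big /= mulr_sumr (reindex pr) /=; last exact: onW_bij.
  rewrite (reindex (@enum_val N (mem N))) /=; last first.
    by apply: onW_bij; exact: enum_val_bij.
 apply: eq_bigr => s _.
  rewrite !mxE /H coordsK !affine_bary_adj ?generic_anchors // -/D /bary'.
  ring.
have v0 : v = 0 by rewrite -[v](mulKmx uQ) Qv mulmx0.
have [pr' _ prK] := prb.
have := congr1 (fun w : 'cV_ _ => w (enum_rank (pr' (j0, k0))) 0) v0.
by rewrite !mxE enum_rankK prK.
Qed.

End QuadricMatrix.

(** * Infinitesimal rigidity of the pinned chain *)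

Lemma card_ends d : (0 < d)%N -> #|('I_2 + 'I_(d - 1) : finType)%type| = (1 + d)%N.
Proof. move=> d0; rewrite card_sum !card_ord; lia. Qed.

Lemma ends_card d (V : finType) (a : 'I_2 + 'I_(d - 1) -> V) :
  (0 < d)%N -> injective a -> (d < #|V|)%N.
Proof. by move=> d0 a_inj; have := leq_card a a_inj; rewrite card_ends. Qed.

Section ChainSides.
Variables (d i m : nat) (V : finType).
Variable a : 'I_2 + 'I_(d - 1) -> V.

(** A 4-chain is bipartite: one side is X1 + X3 and the other one X4 + X2.
    If 2 < i < d - 1 and i + m = 2 (d - 1), both have at least d + 2 vertices, so that
    each of them can lose a vertex and still span the space. *)
Definition sideA (t : 'I_2 + 'I_m) : attach_vertex i m V :=
  match t with inl j => inl (a (inl j)) | inr z => inr (inr z) end.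
Definition sideB (t : 'I_(d - 1) + 'I_i) : attach_vertex i m V :=
  match t with inl k => inl (a (inr k)) | inr y => inr (inl y) end.

Definition chain_pair (tA : 'I_2 + 'I_m) (tB : 'I_(d - 1) + 'I_i) : bool :=
  match tA, tB with inl _, inl _ => false | _, _ => true end.

Hypothesis a_inj : injective a.

Lemma sideA_inj : injective sideA.
Proof. by move=> [j|z] [j'|z'] //= [] => [/a_inj[]->|->]. Qed.

Lemma sideB_inj : injective sideB.
Proof. by move=> [k|y] [k'|y'] //= [] => [/a_inj[]->|->]. Qed.

Lemma sideAB t t' : (sideA t == sideB t') = false.
Proof.
by apply/negP => /eqP; case: t t' => [j|z] [k|y] //= [] // /a_inj.
Qed.

End ChainSides.

Lemma sum_ord2 (W : nmodType) (F : 'I_2 -> W) : \sum_j F j = F 0 + F 1.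
Proof.
rewrite !big_ord_recl big_ord0 addr0; congr (_ + F _); exact/val_inj.
Qed.

Section PinnedFlex.
Variables (R : realType) (d i m : nat) (V : finType).
Variable a : 'I_2 + 'I_(d - 1) -> V.
Hypothesis a_inj : injective a.
Hypotheses (i_gt2 : (2 < i)%N) (i_ltd : (i < d - 1)%N).
Hypothesis im : (i + m = 2 * (d - 1))%N.
Hypothesis cardB : #|('I_2 + 'I_(d - 1) : finType)%type| = (1 + d)%N.

Let U : finType := (V + ('I_i + 'I_m))%type.
Variable p : U -> 'rV[R]_d.
Hypothesis gp : generic p.

Let px (j : 'I_2) := p (inl (a (inl j))).
Let pw (k : 'I_(d - 1)) := p (inl (a (inr k))).
Let py (y : 'I_i) := p (inr (inl y)).
Let pz (z : 'I_m) := p (inr (inr z)).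
Let beta (j : 'I_2) : 'cV[R]_(1 + d) := bary cardB (anchors a p) (inl j).
Let gamma (k : 'I_(d - 1)) : 'cV[R]_(1 + d) := bary cardB (anchors a p) (inr k).

Let beta_x (j j' : 'I_2) : affine (beta j) (px j') = (j == j')%:R.
Proof. by rewrite (bary_anchor (generic_anchors a_inj cardB gp) (inl j) (inl j')). Qed.
Let beta_w (j : 'I_2) (k : 'I_(d - 1)) : affine (beta j) (pw k) = 0.
Proof. by rewrite (bary_anchor (generic_anchors a_inj cardB gp) (inl j) (inr k)). Qed.

Let affine_split f s : affine f s =
  \sum_j affine f (px j) * affine (beta j) s +
  \sum_k affine f (pw k) * affine (gamma k) s.
Proof.
by rewrite (affine_baryE (generic_anchors a_inj cardB gp) f s) big_sumType.
Qed.

Let sA := @sideA d i m V a.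
Let sB := @sideB d i m V a.
Let sA_inj : injective sA := @sideA_inj d i m V a a_inj.
Let sB_inj : injective sB := @sideB_inj d i m V a a_inj.

(* Either side of the chain spans the space after the loss of a vertex: this is
   where the bounds on i enter. *)
Let vanish_A f tA :
  (forall t, t != tA -> affine f (p (sA t)) = 0) -> f = 0.
Proof.
move=> fA; apply: (generic_affine_eq0 (S := sA @: [set~ tA]%SET) gp).
  rewrite card_imset // cardsC1 card_sum !card_ord; lia.
by move=> u /imsetP[t]; rewrite !inE => ttA ->; apply: fA.
Qed.

Let vanish_B f tB :
  (forall t, t != tB -> affine f (p (sB t)) = 0) -> f = 0.
Proof.
move=> fB; apply: (generic_affine_eq0 (S := sB @: [set~ tB]%SET) gp).
  rewrite card_imset // cardsC1 card_sum !card_ord; lia.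
by move=> u /imsetP[t]; rewrite !inE => ttB ->; apply: fB.
Qed.

(** The line through two points of X2 and the flat of X4 span the space, so that
    the two points have independent coordinates beta. *)
Let beta_det y1 y2 : y1 != y2 ->
  affine (beta 0) (py y1) * affine (beta 1) (py y2) -
  affine (beta 1) (py y1) * affine (beta 0) (py y2) != 0.
Proof.
move=> y12; apply/negP => /eqP D0.
have key f y (S := [set sB t | t in [set inl k | k in 'I_(d - 1)]]%SET) :
  (forall k, affine f (pw k) = 0) ->
  (exists u, [/\ u \notin S, u != inr (inl y) & affine f (p u) = 0]) ->
  affine f (py y) = 0 -> f = 0.
  move=> fw [u [uS uy fu]] fy.
  have yS : (inr (inl y) : U) \notin S.
    by apply/negP => /imsetP[t /imsetP[k _ ->]].
  apply: (generic_affine_eq0 (S := u |: (inr (inl y) |: S)) gp).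
    rewrite !cardsU1 !inE negb_or uy uS yS /S !card_imset //; last by move=> ? ? [].
    by rewrite card_ord; lia.
  move=> v; rewrite !inE => /orP[/eqP->//|/orP[/eqP-> //|]].
  by move=> /imsetP[t /imsetP[k _ ->] ->]; exact: fw.
have notS u : (forall k, u != sB (inl k)) ->
    u \notin [set sB t | t in [set inl k | k in 'I_(d - 1)]]%SET.
  by move=> h; apply/negP => /imsetP[t /imsetP[k _ ->]] uE; have /eqP := h k.
pose f := affine (beta 1) (py y1) *: beta 0 - affine (beta 0) (py y1) *: beta 1.
have fE s : affine f s = affine (beta 1) (py y1) * affine (beta 0) s -
    affine (beta 0) (py y1) * affine (beta 1) s.
  by rewrite affineDf affineNf !affineZf.
have f0 : f = 0.
  apply: (key f y1) => [k||]; last by rewrite fE mulrC subrr.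
    by rewrite fE !beta_w !mulr0 subr0.
  exists (inr (inl y2)); split; first exact: notS.
    by apply: contraNneq y12 => -[->].
  by rewrite fE -/(py y2) -[LHS]opprK opprB D0 oppr0.
have b1 : affine (beta 1) (py y1) = 0.
  by have := fE (px 0); rewrite f0 affine0f !beta_x mulr1 mulr0 subr0.
have b0 : affine (beta 0) (py y1) = 0.
  by have /eqP := fE (px 1); rewrite f0 affine0f !beta_x mulr1 mulr0 sub0r eq_sym oppr_eq0 => /eqP.
have bb : beta 0 = 0.
  apply: (key _ y1) => [k||//]; first exact: beta_w.
  exists (inl (a (inl 1))); split => //; last exact: beta_x.
  by apply: notS => k; apply/eqP => -[] /a_inj.
by have /eqP := beta_x 0 0; rewrite bb affine0f eq_sym oner_eq0.
Qed.

Let cramer (u1 u2 v1 v2 w1 w2 : R) : u1 * v2 - u2 * v1 != 0 ->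
  exists c1 c2, w1 = c1 * u1 + c2 * v1 /\ w2 = c1 * u2 + c2 * v2.
Proof.
move=> D0; exists ((w1 * v2 - w2 * v1) / (u1 * v2 - u2 * v1)).
exists ((u1 * w2 - u2 * w1) / (u1 * v2 - u2 * v1)).
by split; field.
Qed.

(** The functions phi_y vanish on X1 and the functions theta_z on X4, up to the
    deleted edge, whose ends are tA and tB. Since theta_z(y) is linear in beta(y),
    so is phi_y(z), and then phi_y itself, because the points of X1 + X3 other
    than tA span the space: phi_y = sum_j beta_j(y) Psi_j. Symmetrically, the
    points of X4 + X2 other than tB show that theta_z = - sum_j Psi_j(z) beta_j.
    As phi_y(y) = 0 and theta_z(z) = 0, the quadric sum_j beta_j Psi_j, which
    contains the line of X1 and the flat of X4, passes through all points of X2 +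
    X3. It is therefore zero. *)
Lemma pinned_flex_eq0 (phi : 'I_i -> 'cV[R]_(1 + d)) (theta : 'I_m -> 'cV[R]_(1 + d))
    (tA : 'I_2 + 'I_m) (tB : 'I_(d - 1) + 'I_i) :
  (forall y, affine (phi y) (py y) = 0) ->
  (forall z, affine (theta z) (pz z) = 0) ->
  (forall y j, ~~ ((tA == inl j) && (tB == inr y)) -> affine (phi y) (px j) = 0) ->
  (forall z k, ~~ ((tA == inr z) && (tB == inl k)) -> affine (theta z) (pw k) = 0) ->
  (forall y z, ~~ ((tA == inr z) && (tB == inr y)) ->
     affine (phi y) (pz z) + affine (theta z) (py y) = 0) ->
  (forall y, phi y = 0) /\ (forall z, theta z = 0).
Proof.
move=> phiy thetaz phix thetaw phitheta.
(* Two vertices of X2 away from the deleted edge; they determine all phi_y. *)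
have [y1 [y2 [y12 y1B y2B]]] : exists y1 y2 : 'I_i,
    [/\ y1 != y2, tB != inr y1 & tB != inr y2].
  have h0 : (0 < i)%N by lia.
  have h1 : (1 < i)%N by lia.
  pose o0 := Ordinal h0; pose o1 := Ordinal h1; pose o2 := Ordinal i_gt2.
  have [e0|n0] := eqVneq tB (inr o0); first by exists o1, o2; rewrite e0.
  have [e1|n1] := eqVneq tB (inr o1); first by exists o0, o2; rewrite e1.
  by exists o0, o1.
have D0 := beta_det y12.
have theta_lin z s : tA != inr z ->
    affine (theta z) s = \sum_j affine (theta z) (px j) * affine (beta j) s.
  move=> zA; rewrite affine_split [X in _ + X]big1 ?addr0 // => k _.
  by rewrite thetaw ?mul0r // (negbTE zA).
have phi_lin y c1 c2 :
    (forall j, affine (beta j) (py y) =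
       c1 * affine (beta j) (py y1) + c2 * affine (beta j) (py y2)) ->
    phi y = c1 *: phi y1 + c2 *: phi y2.
  move=> yE; apply/eqP; rewrite -subr_eq0; apply/eqP.
  apply: (@vanish_A _ tA) => -[j|z] tjA; rewrite affineDf affineNf affineDf !affineZf.
    by rewrite /= !phix ?(negbTE y1B) ?(negbTE y2B) ?andbF ?(eq_sym tA)
      ?(negbTE tjA) // !mulr0 addr0 subr0.
  have zA : tA != inr z by rewrite eq_sym.
  have phiE y' : affine (phi y') (p (sA (inr z))) = - affine (theta z) (py y').
    by apply/eqP; rewrite -addr_eq0 phitheta // (negbTE zA).
  rewrite !phiE !(theta_lin z) // !big_ord_recl !big_ord0 !yE; ring.
pose D := affine (beta 0) (py y1) * affine (beta 1) (py y2) -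
  affine (beta 1) (py y1) * affine (beta 0) (py y2).
(* Psi solves phi_y1 = sum_j beta_j(y1) Psi_j and the same equation for y2. *)
pose Psi (j : 'I_2) : 'cV[R]_(1 + d) := if j == 0 then
    (affine (beta 1) (py y2) / D) *: phi y1 - (affine (beta 1) (py y1) / D) *: phi y2
  else (affine (beta 0) (py y1) / D) *: phi y2 - (affine (beta 0) (py y2) / D) *: phi y1.
have phiPsi y : phi y = \sum_j affine (beta j) (py y) *: Psi j.
  have [c1 [c2 [e1 e2]]] := @cramer _ _ _ _ (affine (beta 0) (py y))
    (affine (beta 1) (py y)) D0.
  rewrite (@phi_lin y c1 c2); last first.
    move=> j; case: (unliftP 0 j) => [k ->|-> //].
    by rewrite (ord1 k) (_ : lift 0 0 = 1 :> 'I_2) //; exact/val_inj.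
  rewrite sum_ord2 /Psi /= e1 e2.
  by apply/colP => r; rewrite !mxE /D; field.
have Psix j j' : affine (Psi j) (px j') = 0.
  have phix0 y : tB != inr y -> affine (phi y) (px j') = 0.
    by move=> yB; rewrite phix // (negbTE yB) andbF.
  rewrite /Psi; case: ifP => _; rewrite affineDf affineNf !affineZf !phix0 //;
  by rewrite !mulr0 subr0.
have thetaPsi z : theta z = - \sum_j affine (Psi j) (pz z) *: beta j.
  apply/eqP; rewrite -addr_eq0; apply/eqP; apply: (@vanish_B _ tB) => -[k|y] tBk.
    rewrite affineDf affine_sumf /= thetaw; last by rewrite andbC eq_sym (negbTE tBk).
    by rewrite add0r big1 // => j _; rewrite affineZf beta_w mulr0.
  rewrite affineDf affine_sumf /= addrC -[RHS](phitheta y z); last first.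
    by rewrite andbC eq_sym (negbTE tBk).
  congr (_ + _); rewrite [in RHS]phiPsi affine_sumf.
  by apply: eq_bigr => j _; rewrite !affineZf mulrC.
have Phi0 n : \sum_j affine (beta j) (p (inr n)) * affine (Psi j) (p (inr n)) = 0.
  case: n => [y|z].
    rewrite -[RHS](phiy y) [in RHS]phiPsi affine_sumf.
    by apply: eq_bigr => j _; rewrite affineZf.
  have /eqP := thetaz z; rewrite [in X in X -> _]thetaPsi affineNf oppr_eq0 affine_sumf.
  move=> /eqP h; rewrite -[RHS]h.
  by apply: eq_bigr => j _; rewrite affineZf mulrC.
have PsiE j s : affine (Psi j) s = \sum_k affine (Psi j) (pw k) * affine (gamma k) s.
  by rewrite affine_split big1 ?add0r // => j' _; rewrite Psix mul0r.
have c0 : forall j k, affine (Psi j) (pw k) = 0.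
  have cardN : #|('I_i + 'I_m : finType)%type| = (2 * (d - 1))%N.
    by rewrite card_sum !card_ord.
  apply: (generic_quadric_eq0 a_inj cardN gp (cardB := cardB)
    (c := fun j k => affine (Psi j) (pw k))) => n.
  rewrite -[RHS](Phi0 n); apply: eq_bigr => j _; rewrite PsiE mulr_sumr.
  by apply: eq_bigr => k _; rewrite -/(beta j) -/(gamma k); ring.
have Psi0 j : Psi j = 0.
  apply: (affine_eq0 (generic_anchors a_inj cardB gp)) => k.
  rewrite /anchors; case: (anchor cardB k) => [j'|k']; [exact: Psix | exact: c0].
split => [y|z]; first by rewrite phiPsi big1 // => j _; rewrite Psi0 scaler0.
by rewrite thetaPsi big1 ?oppr0 // => j _; rewrite Psi0 affine0f scale0r.
Qed.

End PinnedFlex.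

(** * From infinitesimal to local rigidity *)

(** An injective linear map has a left inverse, and the entries of the latter
    provide the constant. *)
Lemma linear_injective_bound (R : realType) (K E : finType) (A : E -> K -> R) :
  (forall h : K -> R, (forall e, \sum_k A e k * h k = 0) -> forall k, h k = 0) ->
  exists2 C : R, 0 <= C &
    forall (h : K -> R) k, `|h k| <= C * \sum_e `|\sum_l A e l * h l|.
Proof.
move=> Ainj.
pose M : 'M[R]_(#|K|, #|E|) := \matrix_(k, e) A (enum_val e) (enum_val k).
have mulM (h : K -> R) e : ((\row_(k < #|K|) h (enum_val k)) *m M) 0 e =
    \sum_l A (enum_val e) l * h l.
  rewrite mxE (reindex (@enum_val K (mem K))) /=; last exact/onW_bij/enum_val_bij.
  by apply: eq_bigr => k _; rewrite !mxE mulrC.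
have frM : row_free M.
  apply: inj_row_free => v vM.
  have vE : v = \row_(k < #|K|) v 0 (enum_rank (enum_val k)).
    by apply/rowP => k; rewrite mxE enum_valK.
  have v0 := Ainj (fun l => v 0 (enum_rank l)).
  apply/rowP => k; rewrite mxE -[k]enum_valK v0 // => e.
  by rewrite -[e](enum_rankK) -(mulM (fun l => v 0 (enum_rank l))) -vE vM mxE.
pose W := pinvmx M.
exists (\sum_e \sum_k `|W e k|); first by do 2!apply: sumr_ge0 => ? _.
move=> h k; pose v := \row_(k < #|K|) h (enum_val k).
have -> : h k = (v *m M *m W) 0 (enum_rank k).
  by rewrite mulmxKp // mxE enum_rankK.
rewrite mxE; apply: le_trans (ler_norm_sum _ _ _) _.
rewrite mulr_suml; apply: ler_sum => e _; rewrite normrM mulrC.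
apply: ler_pM => //.
  by rewrite (bigD1 (enum_rank k)) //= lerDl sumr_ge0.
rewrite mulM (bigD1 (enum_val e : E)) //= lerDl sumr_ge0 //.
Qed.

Section PinnedIsolation.
Variables (R : realType) (d : nat) (V N : finType).
Let U : finType := (V + N)%type.
Variables (p : U -> 'rV[R]_d) (edge : U -> N -> bool).

Definition pinned (h : N -> 'rV[R]_d) : U -> 'rV[R]_d :=
  fun u => match u with inl _ => 0 | inr n => h n end.

(** If a displacement h preserves the lengths of the edges, then its first-order
    effect on them is minus its second-order effect. By infinitesimal rigidity
    |h|^2 is then at most a constant times |h|^4, so h vanishes or is not
    small. *)
Lemma pinned_isolated :
  (forall h : N -> 'rV[R]_d,
     (forall u n, edge u n -> dot (p (inr n) - p u) (h n - pinned h u) = 0) ->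
     forall n, h n = 0) ->
  exists2 c : R, 0 < c & forall h : N -> 'rV[R]_d,
    (forall u n, edge u n ->
      dot (p (inr n) + h n - (p u + pinned h u)) (p (inr n) + h n - (p u + pinned h u)) =
      dot (p (inr n) - p u) (p (inr n) - p u)) ->
    \sum_n dot (h n) (h n) < c -> \sum_n dot (h n) (h n) = 0.
Proof.
move=> inj.
pose dl (u : U) (n n' : N) : R := (n' == n)%:R - (u == inr n')%:R.
pose A (e : U * N) (l : N * 'I_d) : R :=
  if edge e.1 e.2 then (p (inr e.2) - p e.1) 0 l.2 * dl e.1 e.2 l.1 else 0.
have AE (h : N -> 'rV[R]_d) u n : \sum_l A (u, n) l * h l.1 0 l.2 =
    if edge u n then dot (p (inr n) - p u) (h n - pinned h u) else 0.
  rewrite /A /=; case: ifP => _; last by rewrite big1 // => l _; rewrite mul0r.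
  rewrite -(pair_big predT predT (fun n' k =>
    (p (inr n) - p u) 0 k * dl u n n' * h n' 0 k)) /= exchange_big.
  apply: eq_bigr => k _ /=; under eq_bigr do rewrite -mulrA; rewrite -mulr_sumr.
  congr (_ * _); rewrite /dl.
  under eq_bigr do rewrite mulrBl; rewrite big_split /= sumrN ![in RHS]mxE.
  congr (_ - _).
    rewrite (bigD1 n) //= eqxx mul1r big1 ?addr0 // => n' /negbTE ->.
    by rewrite mul0r.
  case: u => [v|n'] /=; first by rewrite mxE big1 // => n' _; rewrite mul0r.
  rewrite (bigD1 n') //= eqxx mul1r big1 ?addr0 // => n'' nn.
  by rewrite (inj_eq (@inr_inj _ _)) eq_sym (negbTE nn) mul0r.
have [|C C0 Cb] := @linear_injective_bound R _ _ A.
  move=> h hA [n k].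
  pose h' n := \row_k h (n, k).
  have h0 : forall n, h' n = 0.
    apply: inj => u n' un; have := hA (u, n'); have := AE h' u n'; rewrite un => <- AhA.
    rewrite -[RHS]AhA; apply: eq_bigr => -[n'' k'] _ /=; by rewrite mxE.
  by have := congr1 (fun w : 'rV_d => w 0 k) (h0 n); rewrite !mxE.
pose T : R := #|{: U * N}|%:R * 2 * C.
pose T2 := 1 + #|{: N * 'I_d}|%:R * T ^+ 2.
have T2_gt0 : 0 < T2 by rewrite ltr_pwDl // mulr_ge0 // sqr_ge0.
exists T2^-1; first by rewrite invr_gt0.
move=> h hE; set S := \sum_n _ => ST.
have S0 : 0 <= S by apply: sumr_ge0 => n _; exact: dot_ge0.
have hS u : dot (pinned h u) (pinned h u) <= S.
  case: u => [v|n]; first by rewrite dot0l.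
  by rewrite /S (bigD1 n) //= lerDl sumr_ge0 // => n' _; exact: dot_ge0.
have Lb e : `|\sum_l A e l * h l.1 0 l.2| <= 2 * S.
  case: e => u n; rewrite AE; case: ifP => [un|_]; last by rewrite normr0 mulr_ge0.
  pose w := h n - pinned h u; pose r := p (inr n) - p u.
  have rw : p (inr n) + h n - (p u + pinned h u) = r + w.
    by rewrite /r /w opprD addrACA.
  have := hE u n un; rewrite rw -/r -/w.
  have wE : w = h n - pinned h u by [].
  clearbody r w; rewrite dotDl !dotDr (dotC w r) => e2.
  have -> : dot r w = - (2^-1 * dot w w) by lra.
  rewrite normrN ger0_norm; last by rewrite mulr_ge0 ?dot_ge0 // invr_ge0.
  have := dot_ge0 (h n + pinned h u); rewrite !dotDl !dotDr.
  have := hS u; have := hS (inr n); rewrite /= wE !dotDl !dotDr !dotNl !dotNr.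
  rewrite (dotC (pinned h u) (h n)); lra.
have hb l : `|h l.1 0 l.2| <= T * S.
  apply: le_trans (Cb (fun l => h l.1 0 l.2) l) _.
  rewrite /T [_ * C]mulrC -!mulrA ler_wpM2l //.
  apply: le_trans (ler_sum _ (fun e _ => Lb e)) _.
  by rewrite sumr_const -[X in X <= _]mulr_natl.
apply/eqP/negP => /negP Sn0; have Sgt0 : 0 < S by rewrite lt_neqAle eq_sym Sn0.
have : S <= #|{: N * 'I_d}|%:R * (T * S) ^+ 2.
  rewrite {1}/S /dot (pair_big predT predT (fun n k => h n 0 k * h n 0 k)) /=.
  apply: (@le_trans _ _ (\sum_(l : N * 'I_d) (T * S) ^+ 2)).
    apply: ler_sum => l _; rewrite -expr2 -real_normK ?num_real //.
    by rewrite ler_pXn2r ?nnegrE // (le_trans _ (hb l)).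
  by rewrite sumr_const -[X in X <= _]mulr_natl.
apply/negP; rewrite -ltNge -[X in _ < X]mul1r.
rewrite (_ : _ * _ = #|{: N * 'I_d}|%:R * T ^+ 2 * S * S); last by ring.
rewrite ltr_pM2r //; apply: le_lt_trans (_ : T2 * S < 1); last first.
  by rewrite mulrC -ltr_pdivlMr // mul1r.
by rewrite ler_wpM2r // /T2 lerDr.
Qed.

End PinnedIsolation.

Section Alignment.
Variables (R : realType) (d : nat).
Implicit Types (c g : 'I_(1 + d) -> 'rV[R]_d) (s t : 'rV[R]_d).

Definition sqdist s t : R := dot (s - t) (s - t).

Lemma sqdistC s t : sqdist s t = sqdist t s.
Proof. by rewrite /sqdist -(opprB s t) dotNl dotNr opprK. Qed.

Lemma dot_mx (u v : 'rV[R]_d) : dot u v = (u *m v^T) 0 0.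
Proof. by rewrite mxE; apply: eq_bigr => k _; rewrite mxE. Qed.

Definition origin : 'I_(1 + d) := lshift d ord0.

Definition edgemx c : 'M[R]_d := \matrix_k (c (rshift 1 k) - c origin).

Lemma edgemx_unit c : hatmx c \in unitmx -> edgemx c \in unitmx.
Proof.
move=> uc; rewrite -unitmx_tr -row_free_unit; apply: inj_row_free => v vB.
have f0 : affine_at (c origin) v = 0.
  apply: (affine_eq0 uc) => k; rewrite affine_atE.
  case: (split_ordP k) => j ->; first by rewrite (ord1 j) subrr dot0l.
  have := congr1 (fun w : 'rV_d => w 0 j) vB; rewrite [in RHS]mxE => e.
  apply/eqP; rewrite -oppr_eq0 -dotNl opprB dotC -[X in _ == X]e; apply/eqP.
  by rewrite mxE; apply: eq_bigr => k' _; rewrite !mxE.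
exact: affine_at_inj f0.
Qed.

Lemma polarization c s k :
  2 * dot (s - c origin) (c k - c origin) =
  sqdist s (c origin) + sqdist (c k) (c origin) - sqdist s (c k).
Proof.
rewrite /sqdist !dotBl !dotBr (dotC (c origin) s) (dotC (c k) s) (dotC (c origin) (c k)).
ring.
Qed.

Variables c g : 'I_(1 + d) -> 'rV[R]_d.
Hypothesis uc : hatmx c \in unitmx.
Hypothesis cg : forall k l, sqdist (g k) (g l) = sqdist (c k) (c l).

(** The linear part of the isometry that carries g to c. With the matrices of edge
    vectors it is the product of the inverse of edgemx g and edgemx c. As the two
    matrices have the same Gram matrix, it can be written without inverting
    edgemx g: it is linear, hence continuous, in g. *)
Definition aligner : 'M[R]_d := (edgemx g)^T *m invmx (edgemx c)^T.

Let gram : edgemx g *m (edgemx g)^T = edgemx c *m (edgemx c)^T.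
Proof.
have entry (f : 'I_(1 + d) -> 'rV[R]_d) k l : (edgemx f *m (edgemx f)^T) k l =
    dot (f (rshift 1 k) - f origin) (f (rshift 1 l) - f origin).
  by rewrite mxE; apply: eq_bigr => j _; rewrite !mxE.
apply/matrixP => k l; rewrite !entry.
apply: (@mulfI _ 2); first by rewrite pnatr_eq0.
by rewrite !polarization !cg.
Qed.

Lemma aligner_dot (u v : 'rV[R]_d) : dot (u *m aligner) (v *m aligner) = dot u v.
Proof.
have uBc := edgemx_unit uc.
suff O1 : aligner *m aligner^T = 1%:M.
  by rewrite !dot_mx trmx_mul mulmxA -(mulmxA u) O1 mulmx1.
apply: mulmx1C; rewrite /aligner trmx_mul trmxK trmx_inv trmxK.
rewrite mulmxA -(mulmxA (invmx _)) gram mulmxA mulVmx // mul1mx.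
by rewrite mulmxV // unitmx_tr.
Qed.

Lemma aligner_eq s s' : (forall k, sqdist s (g k) = sqdist s' (c k)) ->
  (s - g origin) *m aligner = s' - c origin.
Proof.
move=> ss'; have uBc := edgemx_unit uc.
rewrite /aligner mulmxA; suff -> : (s - g origin) *m (edgemx g)^T =
    (s' - c origin) *m (edgemx c)^T by rewrite mulmxK // unitmx_tr.
have entry (f : 'I_(1 + d) -> 'rV[R]_d) r k : (r *m (edgemx f)^T) 0 k =
    dot r (f (rshift 1 k) - f origin).
  by rewrite mxE; apply: eq_bigr => j _; rewrite !mxE.
apply/rowP => k; rewrite !entry.
apply: (@mulfI _ 2); first by rewrite pnatr_eq0.
by rewrite !polarization !ss' cg.
Qed.

End Alignment.

(** Otherwise S would take the value c / 2, by the intermediate value theorem. *)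
Lemma isolated_zero_stays (R : realType) (S : R -> R) (c : R) :
  {within `[0, 1], continuous S} -> S 0 = 0 -> 0 < c ->
  (forall t, t \in `[0, 1] -> 0 <= S t) ->
  (forall t, t \in `[0, 1] -> S t < c -> S t = 0) ->
  forall t, t \in `[0, 1] -> S t = 0.
Proof.
move=> Sc S0 c0 Sge0 Siso t t01; apply: (Siso) => //; rewrite ltNge; apply/negP => St.
have /andP[t0 t1] : 0 <= t <= 1 by rewrite in_itv /= in t01.
have [||t' t't Et'] := @IVT R S 0 t (c / 2) t0.
- apply: continuous_subspaceW Sc => x /=; rewrite !in_itv /= => /andP[-> xt].
  exact: le_trans xt t1.
- by rewrite S0 min_l ?max_r ?Sge0 //; apply/andP; split; lra.
- have t'01 : t' \in `[0, 1].
    by move: t't; rewrite !in_itv /= => /andP[-> /le_trans]; apply.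
  by have := Siso t' t'01; rewrite Et' => /(_ ltac:(lra)); lra.
Qed.

Section WithinContinuity.
Variables (R : realType) (A : set R).
Implicit Types f g : R -> R.

Lemma within_cst (c : R) : {within A, continuous (fun=> c : R)}.
Proof. by move=> x; exact: cvg_cst. Qed.

Lemma within_add f g : {within A, continuous f} -> {within A, continuous g} ->
  {within A, continuous (fun t => f t + g t)}.
Proof. by move=> cf cg x; apply: cvgD; [exact: cf | exact: cg]. Qed.

Lemma within_opp f : {within A, continuous f} ->
  {within A, continuous (fun t => - f t)}.
Proof. by move=> cf x; apply: cvgN; exact: cf. Qed.

Lemma within_mul f g : {within A, continuous f} -> {within A, continuous g} ->
  {within A, continuous (fun t => f t * g t)}.
Proof. by move=> cf cg x; apply: cvgM; [exact: cf | exact: cg]. Qed.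

Lemma within_sum (J : finType) (F : J -> R -> R) :
  (forall j, {within A, continuous (F j)}) ->
  {within A, continuous (fun t => \sum_j F j t)}.
Proof.
move=> cF; elim: (index_enum J) => [|j r IH].
  rewrite (_ : (fun t => _) = fun=> 0); first exact: within_cst.
  by apply/funext => t; rewrite big_nil.
rewrite (_ : (fun t => _) = fun t => F j t + \sum_(j <- r) F j t).
  exact: within_add.
by apply/funext => t; rewrite big_cons.
Qed.

Lemma within_coord d (v : R -> 'rV[R]_d) k :
  {within A, continuous v} -> {within A, continuous (fun t => v t 0 k)}.
Proof.
move=> cv x; apply: (@cvg_comp _ _ _ v (fun w : 'rV_d => w 0 k)); first exact: cv.
exact: coord_continuous.
Qed.

Lemma within_dot d (u v : R -> 'rV[R]_d) :
  (forall k, {within A, continuous (fun t => u t 0 k)}) ->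
  (forall k, {within A, continuous (fun t => v t 0 k)}) ->
  {within A, continuous (fun t => dot (u t) (v t))}.
Proof. by move=> cu cv; apply: within_sum => k; apply: within_mul. Qed.

End WithinContinuity.

Section AttachedChain.
Variables (R : realType) (d i m : nat) (V : finType).
Variable a : 'I_2 + 'I_(d - 1) -> V.
Hypothesis a_inj : injective a.
Hypotheses (i_gt2 : (2 < i)%N) (i_ltd : (i < d - 1)%N).
Hypothesis im : (i + m = 2 * (d - 1))%N.

Let U : finType := attach_vertex i m V.

Let d_gt0 : (0 < d)%N.
Proof. by case: d i_ltd. Qed.

Variables (H : sgraph U) (tA : 'I_2 + 'I_m) (tB : 'I_(d - 1) + 'I_i).
Hypothesis H_chain : forall t t', chain_pair t t' -> (t, t') != (tA, tB) ->
  adj H (sideA i a t) (sideB m a t').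

(** With the velocities encoded by affine functions, the edge conditions are those
    of [pinned_flex_eq0]; the pinned ends contribute nothing. *)
Lemma chain_inf_rigid (p : U -> 'rV[R]_d) (h : 'I_i + 'I_m -> 'rV[R]_d) :
  generic p ->
  (forall u n, adj H u (inr n) -> dot (p (inr n) - p u) (h n - pinned h u) = 0) ->
  forall n, h n = 0.
Proof.
move=> gp hH.
pose phi y := affine_at (p (inr (inl y))) (h (inl y)).
pose theta z := affine_at (p (inr (inr z))) (h (inr z)).
have ne (t t1 : 'I_2 + 'I_m) (t' t1' : 'I_(d - 1) + 'I_i) :
    ~~ ((t1 == t) && (t1' == t')) -> (t, t') != (t1, t1').
  by rewrite xpair_eqE (eq_sym t) (eq_sym t').
have [|||||phi0 theta0] := @pinned_flex_eq0 R d i m V a a_inj i_gt2 i_ltd im (card_ends d_gt0)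
    p gp phi theta tA tB.
- by move=> y; rewrite affine_atE subrr dot0l.
- by move=> z; rewrite affine_atE subrr dot0l.
- move=> y j /ne jy; rewrite affine_atE.
  by have := hH _ (inl y) (@H_chain (inl j) (inr y) isT jy); rewrite /= subr0.
- move=> z k /ne zk; rewrite affine_atE.
  have := hH (sideB m a (inl k)) (inr z); rewrite /= subr0; apply.
  by rewrite adj_sym; apply: (@H_chain (inr z) (inl k) isT).
- move=> y z /ne zy; rewrite !affine_atE.
  have := hH _ (inl y) (@H_chain (inr z) (inr y) isT zy); rewrite /= dotBr => e.
  by rewrite -[RHS]e; congr (_ + _); rewrite -dotNl opprB.
- by case=> [y|z]; [exact: affine_at_inj (phi0 y) | exact: affine_at_inj (theta0 z)].
Qed.

(** At all times a motion is congruent to the initial configuration on V, because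
    G is rigid. Composing it with the isometry that carries d + 1 points of V back
    to their initial positions pins V, and the pinned position is isolated. *)
Theorem attachment_locally_rigid (G : sgraph V) :
  generically_locally_rigid R d G ->
  (forall g h, adj G g h -> adj H (inl g) (inl h)) ->
  generically_locally_rigid R d H.
Proof.
move=> rG GH p fp gp [gam [gam_c gam0 gam_eq [t1 t1_01 ncong]]]; apply: ncong.
have V_cong t : t \in `[0, 1] ->
    forall g h, eucl_dist (p (inl g)) (p (inl h)) = eucl_dist (gam t (inl g)) (gam t (inl h)).
  move=> t01; apply: contrapT => nc.
  apply: (rG (p \o inl)).
  - apply: generic_framework (ends_card d_gt0 a_inj).
    by apply: generic_comp gp => ? ? [].
  - by apply: generic_comp gp => ? ? [].
  - exists (fun t g => gam t (inl g)); split.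
    + by move=> v; exact: gam_c.
    + by rewrite gam0.
    + by move=> s s01 g h /GH; exact: gam_eq.
    + by exists t.
have sqV t : t \in `[0, 1] -> forall g h,
    sqdist (gam t (inl g)) (gam t (inl h)) = sqdist (p (inl g)) (p (inl h)).
  by move=> t01 g h; apply/esym/eucl_dist_eqP/V_cong.
have uc := generic_anchors a_inj (card_ends d_gt0) gp.
pose c k := anchors a p (anchor (card_ends d_gt0) k).
pose g t k := gam t (inl (a (anchor (card_ends d_gt0) k))).
have cg t : t \in `[0, 1] -> forall k l, sqdist (g t k) (g t l) = sqdist (c k) (c l).
  by move=> t01 k l; exact: sqV.
pose O t := aligner c (g t).
pose y t u := c (origin d) + (gam t u - g t (origin d)) *m O t.
have ydist t u v : t \in `[0, 1] -> sqdist (y t u) (y t v) = sqdist (gam t u) (gam t v).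
  move=> t01; rewrite /sqdist /y opprD addrACA subrr add0r -mulmxBl.
  rewrite opprB addrA subrK.
  exact: (aligner_dot uc (cg t t01)).
have yV t v : t \in `[0, 1] -> y t (inl v) = p (inl v).
  move=> t01; rewrite /y (@aligner_eq _ _ _ _ uc (cg t t01) _ (p (inl v))).
    by rewrite addrC subrK.
  by move=> k; exact: sqV.
pose h t n := y t (inr n) - p (inr n).
have yE t u : t \in `[0, 1] -> y t u = p u + pinned (h t) u.
  by move=> t01; case: u => [v|n] /=; rewrite ?yV ?addr0 // /h addrC subrK.
have [c0 c0_gt0 iso] := pinned_isolated (fun h' => @chain_inf_rigid p h' gp).
pose S t := \sum_n dot (h t n) (h t n).
have S0 : forall t, t \in `[0, 1] -> S t = 0.
  apply: (@isolated_zero_stays R S c0) => //.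
  - have cg01 u k : {within `[0, 1], continuous (fun t => gam t u 0 k)}.
      by apply: within_coord; exact: gam_c.
    have gg01 j k : {within `[0, 1], continuous (fun t => g t j 0 k)}.
      exact: (cg01 (inl (a (anchor (card_ends d_gt0) j)))).
    have hc n k : {within `[0, 1], continuous (fun t => h t n 0 k)}.
      rewrite (_ : (fun t0 => _) = fun t0 => c (origin d) 0 k +
        \sum_l (gam t0 (inr n) 0 l - g t0 (origin d) 0 l) *
          (\sum_j (g t0 (rshift 1 j) 0 l - g t0 (origin d) 0 l) *
            invmx (edgemx c)^T j k) - p (inr n) 0 k); last first.
        apply/funext => t0; rewrite /h /y !mxE; congr (_ + _ - _).
        apply: eq_bigr => l _; rewrite !mxE; congr (_ * _).
        by apply: eq_bigr => j _; rewrite !mxE.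
      apply: within_add; last exact: within_cst.
      apply: within_add; first exact: within_cst.
      apply: within_sum => l; apply: within_mul.
        by apply: within_add; [exact: (cg01 (inr n)) | apply: within_opp; exact: gg01].
      apply: within_sum => j; apply: within_mul; last exact: within_cst.
      by apply: within_add; [exact: gg01 | apply: within_opp; exact: gg01].
    by apply: within_sum => n; apply: within_dot => k; exact: hc.
  - rewrite /S big1 // => n _; rewrite (_ : h 0 n = 0) ?dot0l //.
    have I0 : (0 : R) \in `[0, 1] by rewrite in_itv /= lexx ler01.
    have E : (gam 0 (inr n) - g 0 (origin d)) *m O 0 = p (inr n) - c (origin d).
      by apply: (aligner_eq uc (cg 0 I0)) => k; rewrite /g gam0.
    by rewrite /h /y E [c (origin d) + _]addrC subrK subrr.
  - by move=> t' _; apply: sumr_ge0 => n _; exact: dot_ge0.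
  - move=> t' t'01; apply: iso => u n un.
    rewrite -!/(sqdist _ _) -(yE t' u) // -[p (inr n) + _](yE t' (inr n)) // ydist //.
    by apply/eucl_dist_eqP; rewrite -(gam_eq t' t'01) 1?adj_sym.
have yp u : y t1 u = p u.
  rewrite yE //; case: u => [v|n] /=; first by rewrite addr0.
  rewrite (_ : h t1 n = 0) ?addr0 //; apply/eqP; rewrite -dot_eq0.
  have /eqP := S0 t1 t1_01; rewrite psumr_eq0 => [/allP/(_ n (mem_index_enum _))//|].
  by move=> n' _; exact: dot_ge0.
by move=> u v; apply/eucl_dist_eqP; rewrite -!/(sqdist _ _) -ydist // !yp.
Qed.

End AttachedChain.

Section AttachmentEdges.
Variables (d i m : nat) (V : finType) (G : sgraph V).
Variable a : 'I_2 + 'I_(d - 1) -> V.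
Hypothesis a_inj : injective a.

Let H := @attachment 2 i m (d - 1) V G a.
Let sA := @sideA d i m V a.
Let sB := @sideB d i m V a.

Lemma attach_adj_ground g h : adj G g h -> adj H (inl g) (inl h).
Proof.
move=> gh; apply/orP; left; apply/existsP; exists g; apply/existsP; exists h.
by rewrite gh !eqxx.
Qed.

Let chain_vA (t : 'I_2 + 'I_m) : chain_vertex 2 i m (d - 1) :=
  match t with inl j => inl (inl j) | inr z => inr (inr z) end.
Let chain_vB (t : 'I_(d - 1) + 'I_i) : chain_vertex 2 i m (d - 1) :=
  match t with inl k => inl (inr k) | inr y => inr (inl y) end.

Lemma attach_adj_chain t t' : chain_pair t t' -> adj H (sA t) (sB t').
Proof.
move=> tt'; apply/orP; right; apply/existsP; exists (chain_vA t).
apply/existsP; exists (chain_vB t'); apply/and3P; split.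
- by case: t t' tt' => [j|z] [k|y].
- by case: t {tt'}.
- by case: t' {tt'}.
Qed.

Lemma attach_adjP u v : adj H u v ->
  (exists g h, [/\ adj G g h, u = inl g & v = inl h]) \/
  (exists t t', chain_pair t t' /\
     ((u = sA t /\ v = sB t') \/ (u = sB t' /\ v = sA t))).
Proof.
case/orP => /existsP[g /existsP[h /and3P[gh /eqP <- /eqP <-]]].
  by left; exists g, h.
right; case: g gh => [[j|k]|[y|z]]; case: h => [[j'|k']|[y'|z']] // _.
- by exists (inl j), (inr y'); split => //; left.
- by exists (inr z'), (inl k); split => //; right.
- by exists (inl j'), (inr y); split => //; right.
- by exists (inr z'), (inr y); split => //; right.
- by exists (inr z), (inl k'); split => //; left.
- by exists (inr z), (inr y'); split => //; left.
Qed.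

Lemma chain_pair_set t t' tA tB :
  [set sA t; sB t']%SET = [set sA tA; sB tB]%SET -> (t, t') = (tA, tB).
Proof.
move=> /finset.setP E; have := E (sA t); have := E (sB t'); rewrite !inE !eqxx orbT /=.
rewrite (eq_sym (sB t') (sA tA)) !(sideAB a_inj) orbF /=
  (inj_eq (sideA_inj a_inj)) (inj_eq (sideB_inj a_inj)).
by move=> /esym/eqP -> /esym/eqP ->.
Qed.

End AttachmentEdges.

Section AttachmentRigidity.
Variables (R : realType) (d i m : nat) (V : finType) (G : sgraph V).
Variable a : 'I_2 + 'I_(d - 1) -> V.
Hypothesis a_inj : injective a.
Hypotheses (i_gt2 : (2 < i)%N) (i_ltd : (i < d - 1)%N).
Hypothesis im : (i + m = 2 * (d - 1))%N.

Let H := @attachment 2 i m (d - 1) V G a.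

(** If the deleted edge belongs to G, what is left of G is rigid and the chain is
    intact; otherwise G is intact and the chain is rigid without the edge. In the
    first case t0 and t0' are both in X1 + X4, so that they are not an edge of the
    chain. *)
Theorem attachment_redundantly_rigid :
  generically_redundantly_rigid R d G -> generically_redundantly_rigid R d H.
Proof.
move=> [rG rrG]; have d1 : (0 < d - 1)%N by lia.
pose t0 : 'I_2 + 'I_m := inl ord0.
pose t0' : 'I_(d - 1) + 'I_i := inl (Ordinal d1).
split.
  apply: (attachment_locally_rigid a_inj i_gt2 i_ltd im (tA := t0) (tB := t0') _ rG).
    by move=> t t' tt' _; exact: attach_adj_chain.
  exact: attach_adj_ground.
move=> u v /attach_adjP [[g [h [gh -> ->]]]|[tA [tB [tAB uv]]]].
  apply: (attachment_locally_rigid a_inj i_gt2 i_ltd im (tA := t0) (tB := t0') _ (rrG _ _ gh)).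
    move=> t t' tt' _; apply/andP; split; first exact: attach_adj_chain.
    apply/eqP => /finset.setP E.
    case: t t' tt' E => [j|z] [k|y] // _ E.
    - by have := E (inr (inl y)); rewrite !inE eqxx orbT.
    - by have := E (inr (inr z)); rewrite !inE eqxx.
    - by have := E (inr (inr z)); rewrite !inE eqxx.
  move=> g' h' /andP[g'h' ne]; apply/andP; split; first exact: attach_adj_ground.
  apply: contraNN ne => /eqP E; apply/eqP/finset.setP => x.
  by have /finset.setP/(_ (inl x)) := E; rewrite !inE.
have setE : [set u; v]%SET = [set sideA i a tA; sideB m a tB]%SET.
  by case: uv => -[-> ->] //; rewrite finset.setUC.
apply: (attachment_locally_rigid a_inj i_gt2 i_ltd im (tA := tA) (tB := tB) _ rG).
  move=> t t' tt' ne; apply/andP; split; first exact: attach_adj_chain.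
  by rewrite setE; apply: contraNneq ne => /(chain_pair_set a_inj) ->.
move=> g h gh; apply/andP; split; first exact: attach_adj_ground.
rewrite setE; apply/eqP => /finset.setP E.
case: tA tB tAB {uv setE} E => [j|z] [k|y] // _ E.
- by have := E (inr (inl y)); rewrite !inE eqxx orbT.
- by have := E (inr (inr z)); rewrite !inE eqxx.
- by have := E (inr (inr z)); rewrite !inE eqxx.
Qed.

End AttachmentRigidity.

(** * Connectivity *)

Section SimplexRigidity.
Variables (R : realType) (d : nat) (V : finType) (G : sgraph V).
Hypotheses (d_gt1 : (1 < d)%N) (cardV : #|V| = (1 + d)%N).

(** If u and v were not adjacent, u could rotate about the flat of codimension 2
    that is spanned by the vertices other than u and v. The gradient of the
    barycentric coordinate of v is normal to the hyperplane through all of them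
    and u, hence it is the direction in which u starts to move, and its distance
    to v changes. *)
Lemma rigid_simplex_complete : generically_locally_rigid R d G -> graph_complete G.
Proof.
move=> rG u v uv; apply: contraT => nadj; exfalso.
have [p _ gp] := exists_generic (fun _ : V => 0 : 'rV[R]_d) ltr01.
have fp : framework p by apply: generic_framework; rewrite ?cardV.
apply: (rG p fp gp).
have up : anchormx cardV p \in unitmx.
  by apply: (generic_hatmx gp); exact: can_inj (anchorK cardV).
pose grad x := gradient (bary cardV p x).
have gradE x y z : dot (p y - p z) (grad x) = (x == y)%:R - (x == z)%:R.
  by rewrite -affineB !bary_anchor.
pose r0 := grad u - (dot (grad u) (grad v) / dot (grad v) (grad v)) *: grad v.
have gv0 : dot (grad v) (grad v) != 0.
  rewrite dot_eq0; apply/eqP => g0; have := gradE v v u.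
  rewrite g0 dotC dot0l eqxx eq_sym (negbTE uv) subr0 => /eqP.
  by rewrite eq_sym oner_eq0.
have r0v : dot r0 (grad v) = 0 by rewrite dotBl dotZl divfK // subrr.
have r0w w : w != u -> w != v -> dot (p u - p w) r0 = 1.
  move=> wu wv; rewrite dotBr dotZr !gradE eqxx (eq_sym u w) (negbTE wu).
  by rewrite (eq_sym v u) (negbTE uv) (eq_sym v w) (negbTE wv) subrr mulr0 !subr0.
have r00 : dot r0 r0 != 0.
  have [w] : exists w, w \notin [set u; v]%SET.
    apply/existsP; rewrite -negb_forall; apply/negP => /forallP uvV.
    have : [set u; v]%SET = [set: V]%SET by apply/finset.setP => w; rewrite uvV inE.
    by move=> /(congr1 (fun A : {set V} => #|A|)); rewrite cardsT cards2 uv cardV; lia.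
  rewrite !inE negb_or => /andP[wu wv]; rewrite dot_eq0; apply/eqP => z.
  by have /eqP := r0w w wu wv; rewrite z dotC dot0l eq_sym oner_eq0.
(* The vector from the axis of rotation to u. *)
pose rho := (dot r0 r0)^-1 *: r0.
have rho_w w : w != u -> w != v -> dot (p u - p w) rho = dot rho rho.
  by move=> wu wv; rewrite !(dotZr, dotZl) r0w // mulVf.
have rr0 : dot rho rho != 0.
  by rewrite !(dotZr, dotZl) mulVf // mulr1 invr_neq0.
have rv : dot rho (grad v) = 0 by rewrite dotZl r0v mulr0.
clearbody rho.
pose s := Num.sqrt (dot rho rho / dot (grad v) (grad v)).
have s2 : s ^+ 2 * dot (grad v) (grad v) = dot rho rho.
  by rewrite sqr_sqrtr ?divfK // divr_ge0 // dot_ge0.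
have s0 : s != 0.
  by apply: contraNneq rr0 => s0; rewrite -s2 s0 expr0n mul0r.
(* Rotation by the angle 2 atan t: with k = 2 / (1 + t^2), its cosine is 1 - t^2 k
   and its sine is t k. *)
pose k (t : R) := 2 / (1 + t ^+ 2).
have den t : 1 + t ^+ 2 != 0 :> R by rewrite gt_eqF // ltr_pwDl // sqr_ge0.
pose z t := k t *: (t *: (s *: grad v) - t ^+ 2 *: rho).
have zz t : dot (z t) (z t) = k t * (2 * t ^+ 2 * dot rho rho).
  rewrite /z !(dotZl, dotZr, dotBl, dotBr) (dotC (grad v) rho) rv !mulr0 subr0 sub0r.
  rewrite (_ : t * (s * (t * (s * _))) = t ^+ 2 * (s ^+ 2 * dot (grad v) (grad v))); last by ring.
  by rewrite s2 /k; field.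
have moved x t : sqdist (p u + z t) (p x) - sqdist (p u) (p x) =
    k t * (2 * t * (s * dot (p u - p x) (grad v)) +
           2 * t ^+ 2 * (dot rho rho - dot (p u - p x) rho)).
  rewrite /sqdist addrAC; set e := p u - p x.
  have eE : e = p u - p x by [].
  clearbody e; rewrite dotDl !dotDr zz (dotC (z t) e).
  by rewrite /z !(dotZr, dotBr); ring.
pose gam t x := if x == u then p u + z t else p x.
exists gam; split.
- move=> x; apply: continuous_subspaceT => t; rewrite /gam; case: (x == u); last exact: cvg_cst.
  have ck : {for t, continuous k}.
    apply: cvgM; first exact: cvg_cst.
    apply: cvgV; first exact: den.
    by apply: cvgD; [exact: cvg_cst | apply: exprn_continuous].
  apply: cvgD; first exact: cvg_cst.
  apply: cvgZ; first exact: ck.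
  apply: cvgB; first by apply: cvgZ; [exact: cvg_id | exact: cvg_cst].
  by apply: cvgZ; [apply: exprn_continuous | exact: cvg_cst].
- apply/funext => x; rewrite /gam; case: eqVneq => // ->.
  by rewrite /z scale0r expr0n scale0r subr0 scaler0 addr0.
- move=> t _; have key y : adj G u y -> sqdist (p u) (p y) = sqdist (p u + z t) (p y).
    move=> uy; apply/eqP; rewrite eq_sym -subr_eq0 moved.
    have yu : y != u by apply: contraTneq uy => ->; rewrite adj_irrefl.
    have yv : y != v by apply: contraTneq uy => ->.
    rewrite gradE (eq_sym v u) (negbTE uv) (eq_sym v y) (negbTE yv) subrr.
    by rewrite rho_w // subrr !mulr0 addr0 mulr0.
  move=> x y xy; apply/eucl_dist_eqP; rewrite /gam.
  case: (eqVneq x u) xy => [->|xu]; case: (eqVneq y u) => [->|yu] //.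
  + by rewrite adj_irrefl.
  + exact: key.
  + by rewrite adj_sym -!/(sqdist _ _) !(sqdistC (p x)); exact: key.
- have B0 : s * dot (p u - p v) (grad v) != 0.
    by rewrite gradE (eq_sym v u) (negbTE uv) eqxx sub0r mulrN1 oppr_eq0.
  apply: contrapT => nex.
  have still t : 0 <= t <= 1 -> k t * (2 * t * (s * dot (p u - p v) (grad v)) +
           2 * t ^+ 2 * (dot rho rho - dot (p u - p v) rho)) = 0.
    move=> t01; rewrite -moved; apply/eqP; rewrite subr_eq0; apply/eqP.
    apply: contrapT => ne; apply: nex; exists t; first by rewrite in_itv.
    move=> /(_ u v)/eucl_dist_eqP; rewrite /gam eqxx eq_sym (negbTE uv) => E.
    exact/ne/esym.
  have k0 t : k t != 0 by rewrite mulf_neq0 ?invr_neq0 ?pnatr_eq0.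
  have still' t : 0 <= t <= 1 -> 2 * t * (s * dot (p u - p v) (grad v)) +
           2 * t ^+ 2 * (dot rho rho - dot (p u - p v) rho) = 0.
    by move=> t01; apply: (mulfI (k0 t)); rewrite still // mulr0.
  have e1 := still' 1 ltac:(rewrite ler01 lexx //).
  have e2 := still' 2^-1 ltac:(apply/andP; split; lra).
  move: B0; apply/negP; rewrite negbK; apply/eqP; nra.
Qed.

End SimplexRigidity.

Lemma exists_set_between (T : finType) (A C : {set T}) n :
  A \subset C -> (#|A| <= n <= #|C|)%N ->
  exists B : {set T}, [/\ A \subset B, B \subset C & #|B| = n].
Proof.
have [k] := ubnP (n - #|A|)%N; elim: k A => // k IH A nk AC /andP[An nC].
have [eA|neA] := eqVneq #|A| n; first by exists A.
have ltAC : (#|A| < #|C|)%N by lia.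
have [c] : exists c, c \in C :\: A.
  by apply/set0Pn; rewrite -card_gt0 cardsD (finset.setIidPr AC) subn_gt0.
rewrite inE => /andP[cA cC].
have cardcA : #|c |: A| = #|A|.+1 by rewrite cardsU1 cA.
have [|||B [AB BC Bn]] := IH (c |: A)%SET.
- by rewrite cardcA; lia.
- by rewrite finset.subUset finset.sub1set cC AC.
- by rewrite cardcA; lia.
by exists B; split => //; apply: fintype.subset_trans AB; apply: finset.subsetUr.
Qed.

Lemma connect_map (T T' : finType) (e : rel T) (e' : rel T') (f : T -> T') :
  (forall x y, e x y -> e' (f x) (f y)) ->
  forall x y, connect e x y -> connect e' (f x) (f y).
Proof.
move=> fe x y /connectP[s]; elim: s x => [|z s IH] x /=; first by move=> _ ->.
by move=> /andP[/fe xz sp] yE; apply: connect_trans (connect1 xz) (IH _ sp yE).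
Qed.

Section AttachmentConnectivity.
Variables (d i m : nat) (V : finType) (G : sgraph V).
Variable a : 'I_2 + 'I_(d - 1) -> V.
Hypothesis a_inj : injective a.
Hypotheses (i_gt2 : (2 < i)%N) (i_ltd : (i < d - 1)%N).
Hypothesis im : (i + m = 2 * (d - 1))%N.
Hypothesis G_conn : k_connected d.+1 G.
Hypothesis G_complete : #|V| = (1 + d)%N -> graph_complete G.

Let H := @attachment 2 i m (d - 1) V G a.
Let U : finType := attach_vertex i m V.

(** What is left of G is connected: G is complete if V has only d + 1 vertices. If
    fewer than d vertices are missing from V, remove more of them while keeping
    the two that are to be joined, which needs d + 2 vertices. A remaining vertex
    of X2 sees X1 unless X1 is removed completely; then at most d - 2 other
    vertices are missing, which is not enough to remove X3 or X4. A remaining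
    vertex of X3 sees X4 unless X4 is removed completely, and then neither X2 nor
    X1 is. *)
Lemma attachment_connected : k_connected d.+1 H.
Proof.
move=> T /= cardT; pose vert := {u : U | u \notin T}.
pose e : rel vert := adj (del_verts H T).
have e_sym : connect_sym e by apply: sym_connect_sym => x y; exact: adj_sym.
pose vt u (uT : u \notin T) : vert := exist _ u uT.
have d_gt0 : (0 < d)%N by lia.
have cardV : (d < #|V|)%N := ends_card d_gt0 a_inj.
have big (J : finType) (f : J -> U) : injective f -> (d < #|J|)%N ->
    exists j, f j \notin T.
  move=> finj dJ; apply/existsP; rewrite -negb_forall; apply/negP => /forallP fT.
  suff : (#|J| <= d)%N by rewrite leqNgt dJ.
  rewrite -cardT.
  rewrite -cardsT -(card_imset _ finj); apply: subset_leq_card.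
  by apply/fintype.subsetP => u /imsetP[j _ ->]; exact: fT.
have ground (x y : V) (xT : inl x \notin T) (yT : inl y \notin T) :
    connect e (vt _ xT) (vt _ yT).
  have [xy|xy] := eqVneq x y.
    by move: xT yT; rewrite xy => xT yT; rewrite (bool_irrelevance xT yT) connect0.
  have [eV|neV] := eqVneq #|V| (1 + d)%N.
    apply: connect1; apply: attach_adj_ground; exact: G_complete.
  pose TV := [set v : V | inl v \in T]%SET.
  have cardTV : (#|TV| <= d)%N.
    rewrite -cardT -(card_imset _ (@inl_inj V ('I_i + 'I_m))).
    apply: subset_leq_card; apply/fintype.subsetP => u /imsetP[v].
    by rewrite inE => ? ->.
  have [|| S [TS SC cardS]] := @exists_set_between _ TV (~: [set x; y])%SET d.
  - apply/fintype.subsetP => v; rewrite !inE; apply: contraTN.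
    by case/orP => /eqP ->.
  - by have := cardsC [set x; y]%SET; rewrite cards2 xy; lia.
  have xS : x \notin S.
    by apply/negP => /(fintype.subsetP SC); rewrite !inE eqxx.
  have yS : y \notin S.
    by apply/negP => /(fintype.subsetP SC); rewrite !inE eqxx orbT.
  have liftT (v : {v : V | v \notin S}) : (inl (val v) : U) \notin T.
    by have := valP v; apply: contraNN => vT; apply: (fintype.subsetP TS); rewrite inE.
  have := @connect_map _ _ (adj (del_verts G S)) e (fun v => vt _ (liftT v)) _
    (exist _ x xS) (exist _ y yS) (G_conn cardS _ _).
  rewrite (bool_irrelevance (liftT (exist _ x xS)) xT).
  rewrite (bool_irrelevance (liftT (exist _ y yS)) yT); apply.
  by move=> g h gh; exact: attach_adj_ground.
have chain_e t t' (tT : sideA i a t \notin T) (tT' : sideB m a t' \notin T) :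
    chain_pair t t' -> e (vt _ tT) (vt _ tT').
  exact: attach_adj_chain.
have e_symm x y : e x y -> connect e y x.
  by move=> xy; apply: connect1; rewrite /e adj_sym.
have reach (u : vert) : exists v (vT : inl v \notin T), connect e u (vt _ vT).
  have endsT : exists t, (inl (a t) : U) \notin T.
    by apply: (big _ (fun t => inl (a t))) => [x y [] /a_inj|]; rewrite // card_ends.
  case: u => -[v|[y|z]] uT; first by exists v, uT; apply: connect0.
  - have [/existsP[j jT]|/existsPn X1T] := boolP [exists j, (inl (a (inl j)) : U) \notin T].
      exists (a (inl j)), jT; rewrite e_sym; apply: connect1.
      exact: (@chain_e (inl j) (inr y) jT uT).
    have [[j|k] kT] := endsT; first by have := X1T j; rewrite kT.
    have [|[j|z] zT] := big _ _ (sideA_inj (i := i) a_inj).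
    + by rewrite card_sum !card_ord; lia.
    + by have := X1T j; rewrite zT.
    exists (a (inr k)), kT.
    apply: (@connect_trans _ e (vt _ zT)).
      by rewrite e_sym; apply: connect1; exact: (@chain_e (inr z) (inr y)).
    by apply: connect1; exact: (@chain_e (inr z) (inl k)).
  - have [/existsP[k kT]|/existsPn X4T] := boolP [exists k, (inl (a (inr k)) : U) \notin T].
      exists (a (inr k)), kT; apply: connect1.
      exact: (@chain_e (inr z) (inl k) uT kT).
    have [[j|k] jT] := endsT; last by have := X4T k; rewrite jT.
    have [|[k|y] yT] := big _ _ (sideB_inj (m := m) a_inj).
    + by rewrite card_sum !card_ord; lia.
    + by have := X4T k; rewrite yT.
    exists (a (inl j)), jT.
    apply: (@connect_trans _ e (vt _ yT)).
      by apply: connect1; exact: (@chain_e (inr z) (inr y)).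
    by rewrite e_sym; apply: connect1; exact: (@chain_e (inl j) (inr y)).
move=> u w; have [v [vT uv]] := reach u; have [v' [vT' wv']] := reach w.
apply: connect_trans uv _; rewrite e_sym.
by apply: connect_trans wv' _; exact: ground.
Qed.

End AttachmentConnectivity.

(** * A perturbed linear system *)

(* Rows are a complete normed space, as the fixed point theorem requires. *)
HB.instance Definition _ (R : realType) m n := Complete.on 'M[R]_(m, n).

Section RowNorm.
Variables (R : realType) (n : nat).
Implicit Types v : 'rV[R]_n.

Lemma row_norm_le v (r : R) : 0 <= r -> (forall k, `|v 0 k| <= r) -> `|v| <= r.
Proof.
move=> r0 vr; rewrite /Num.norm /= mx_normrE; apply: bigmax_le => // -[i k] _ /=.
by rewrite ord1.
Qed.

Lemma row_norm_ge v k : `|v 0 k| <= `|v|.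
Proof.
rewrite [X in _ <= X]/Num.norm /= mx_normrE.
exact: (le_bigmax _ (fun ij : 'I_1 * 'I_n => `|v ij.1 ij.2|) (0, k)).
Qed.

Lemma ball_contraction (r : R) (T : 'rV[R]_n -> 'rV[R]_n) : 0 < r ->
  (forall z z', `|z| <= r -> `|z'| <= r -> `|T z - T z'| <= 2^-1 * `|z - z'|) ->
  `|T 0| <= r / 2 -> exists2 z, `|z| <= r & T z = z.
Proof.
move=> r0 Tc T0; pose B := [set z : 'rV[R]_n | `|z| <= r].
have B0 : B 0 by rewrite /B /= normr0 ltW.
have TB z : B z -> B (T z).
  move=> Bz; have := Tc z 0 Bz B0; rewrite subr0 => Tz.
  rewrite /B /= -[T z](subrK (T 0)); apply: le_trans (ler_normD _ _) _.
  by move: Bz; rewrite /B /=; lra.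
have funT : set_fun B B T by move=> z; exact: TB.
pose f : {fun B >-> B} := HB.pack T (isFun.Build _ _ _ _ _ funT).
have [||| z Bz fz] := @banach_fixed_point R _ B f.
- exists (2^-1)%:nng => /=; split; first by rewrite invf_lt1 // ltr1n.
  by move=> [z z'] /= [Bz Bz']; exact: Tc.
- apply: (@closed_comp _ _ (fun z : 'rV[R]_n => `|z|) [set y | y <= r]).
    by move=> z _; exact: norm_continuous.
  exact: closed_le.
- by exists 0.
by exists z => //; rewrite [RHS]fz.
Qed.

End RowNorm.

Section PerturbedSystem.
Variables (R : realType) (K N : finType) (pr : N -> K) (n0 : N).
Hypothesis pr_bij : bijective pr.
Variables (P : Type) (good : P -> Prop).
Variables (Q : P -> N -> K -> R) (Rm : P -> N -> (K -> R) -> R) (g L : R).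
Hypotheses (g_gt0 : 0 < g) (L_ge0 : 0 <= L).
Hypothesis Rm_bound : forall p n w, good p -> (forall k, `|w k| <= 1) ->
  `|Rm p n w| <= L.
Hypothesis Rm_lip : forall p n w w' r, good p -> 0 <= r ->
  (forall k, `|w k| <= 1) -> (forall k, `|w' k| <= 1) ->
  (forall k, `|w k - w' k| <= r) -> `|Rm p n w - Rm p n w'| <= L * r.

Let k0 := pr n0.

(** The unknowns are the numbers w k for k <> k0 and the scale s = w k0, and the
    vector zeta with zeta k0 = 1 and zeta k = w k for k <> k0 has to satisfy Q
    zeta + s Rm = 0. In the limit where Q is the identity with its row n0 replaced
    by 0, the equations n <> n0 determine zeta to first order, while equation n0
    determines s, since Rm n0 is close to g > 0 there. Newton's method for this
    limit system is a contraction near 0 once s is written as a small constant eps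
    times the unknown: this makes the influence of s on the other equations
    small. *)
Lemma perturbed_system_solution : exists2 eta : R, 0 < eta & forall p, good p ->
  (forall n k, `|Q p n k - ((n != n0) && (pr n == k))%:R| <= eta) ->
  `|Rm p n0 (fun=> 0) - g| <= eta ->
  exists w : K -> R, [/\ forall k, `|w k| <= 1, 16 * (L + 1) * `|w k0| <= 1 &
    forall n, \sum_k Q p n k * (if k == k0 then 1 else w k) + w k0 * Rm p n w = 0].
Proof.
have [inv invK prK] := pr_bij.
have g0 := g_gt0; have L0 := L_ge0.
pose kN : R := #|K|%:R.
(* eps tames the terms s Rm in the equations n <> n0, rho keeps Rm n0 close to g on
   the ball of radius rho, and eta is below all tolerances that result. *)
pose eps := (16 * (L + 1))^-1.
have L1_gt0 : 0 < 16 * (L + 1) by lra.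
have eps_gt0 : 0 < eps by rewrite invr_gt0.
have epsL : 16 * (eps * L) + 16 * eps = 1.
  have L1 : 16 * (L + 1) != 0 by rewrite gt_eqF.
  by rewrite -[RHS](mulVf L1) -/eps; ring.
have eps16 : eps * (16 * (L + 1)) = 1 by rewrite -[RHS]epsL; ring.
have epsL0 : 0 <= eps * L by rewrite mulr_ge0 // ltW.
have eps1 : eps <= 1 by lra.
have epsL2 : eps * L <= 16^-1 by lra.
pose rho := g / (16 * (L + 1) + g).
have Lg_gt0 : 0 < 16 * (L + 1) + g by lra.
have rho_gt0 : 0 < rho by rewrite divr_gt0.
have rhoE : 16 * (L * rho) + 16 * rho + rho * g = g.
  have Lg : 16 * (L + 1) + g != 0 by rewrite gt_eqF.
  by rewrite -[RHS](divfK Lg) -/rho; ring.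
have rho1 : rho <= 1 by rewrite ler_pdivrMr //; lra.
have rhoL : L * rho <= g / 16.
  have rg : 0 <= rho * g by rewrite mulr_ge0 // ltW.
  by lra.
pose D := 8 * kN + 8 * kN / (eps * g) + 16 / g + 2 / rho + 2 / (rho * (eps * g)).
have kN0 : 0 <= kN by rewrite ler0n.
have eg0 : 0 < eps * g by rewrite mulr_gt0.
have d1 : 0 <= 8 * kN by rewrite mulr_ge0.
have d2 : 0 <= 8 * kN / (eps * g) by rewrite divr_ge0 // ltW.
have d3 : 0 < 16 / g by rewrite divr_gt0.
have d4 : 0 < 2 / rho by rewrite divr_gt0.
have d5 : 0 < 2 / (rho * (eps * g)) by rewrite divr_gt0 // mulr_gt0.
have D_gt0 : 0 < D by rewrite /D; lra.
pose eta := D^-1; have eta_gt0 : 0 < eta by rewrite invr_gt0.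
have etaD c : c <= D -> c * eta <= 1 by move=> cD; rewrite ler_pdivrMr // mul1r.
have e1 : kN * eta <= 8^-1 by have := etaD (8 * kN) ltac:(rewrite /D; lra); lra.
have e2 : kN * eta / (eps * g) <= 8^-1.
  by have := etaD (8 * kN / (eps * g)) ltac:(rewrite /D; lra); lra.
have e3 : eta <= g / 16.
  have := etaD (16 / g) ltac:(rewrite /D; lra).
  by rewrite mulrAC ler_pdivrMr // mul1r; lra.
have e4 : eta <= rho / 2.
  have := etaD (2 / rho) ltac:(rewrite /D; lra).
  by rewrite mulrAC ler_pdivrMr // mul1r; lra.
have e5 : eta / (eps * g) <= rho / 2.
  have := etaD (2 / (rho * (eps * g))) ltac:(rewrite /D; lra).
  rewrite mulrAC ler_pdivrMr; last exact: mulr_gt0.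
  rewrite mul1r => h; rewrite ler_pdivrMr //.
  by rewrite (_ : rho / 2 * (eps * g) = rho * (eps * g) / 2); [lra | ring].
clearbody eta eps rho; clear D D_gt0 etaD d1 d2 d3 d4 d5.
exists eta => // p gp Qp Rp.
pose coo (z : 'rV[R]_#|K|) k := z 0 (enum_rank k).
pose w z k := if k == k0 then eps * coo z k else coo z k.
pose F z n := \sum_k Q p n k * (if k == k0 then 1 else w z k) + w z k0 * Rm p n (w z).
pose T z : 'rV[R]_#|K| := \row_l
  let k := enum_val l in
  if k == k0 then coo z k - F z (inv k) / (eps * g) else coo z k - F z (inv k).
have coo_le z k : `|coo z k| <= `|z| by exact: row_norm_ge.
have cooB z z' k : `|coo z k - coo z' k| <= `|z - z'|.
  by have := coo_le (z - z') k; rewrite /coo !mxE.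
have w_le z k : `|w z k| <= `|z|.
  rewrite /w; case: ifP => _ //; rewrite normrM gtr0_norm //.
  by have := coo_le z k; have := normr_ge0 (coo z k); nra.
have wB z z' k : `|w z k - w z' k| <= `|z - z'|.
  rewrite /w; case: ifP => _ //; rewrite -mulrBr normrM gtr0_norm //.
  by have := cooB z z' k; have := normr_ge0 (coo z k - coo z' k); nra.
have lin z z' n : `|z| <= rho -> `|z'| <= rho ->
    exists c1 c2, [/\ F z n - F z' n = (if n == n0 then 0 else coo z (pr n) - coo z' (pr n)) + c1 +
       eps * ((coo z k0 - coo z' k0) * Rm p n (w z) + c2),
       `|c1| <= kN * eta * `|z - z'| & `|c2| <= rho * (L * `|z - z'|)].
  move=> zr z'r.
  exists (\sum_k (Q p n k - ((n != n0) && (pr n == k))%:R) *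
            (if k == k0 then 0 else coo z k - coo z' k)).
  exists (coo z' k0 * (Rm p n (w z) - Rm p n (w z'))); split.
  - have -> : (if n == n0 then 0 else coo z (pr n) - coo z' (pr n)) =
        \sum_k ((n != n0) && (pr n == k))%:R * (if k == k0 then 0 else coo z k - coo z' k).
      have [->|nn] := eqVneq n n0.
        by rewrite big1 // => k _; rewrite mul0r.
      rewrite (bigD1 (pr n)) //= eqxx mul1r big1 ?addr0 => [|k /negbTE kn]; last first.
        by rewrite eq_sym kn mul0r.
      by rewrite /k0 (bij_eq pr_bij) (negbTE nn).
    rewrite -big_split /= /F opprD addrACA -sumrB.
    congr (_ + _); last by rewrite /w !eqxx; ring.
    apply: eq_bigr => k _; rewrite /w.
    have expand (q D x y : R) : q * x - q * y = D * (x - y) + (q - D) * (x - y) by ring.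
    case: (k == k0); last exact: expand.
    by rewrite subrr !mulr0 addr0.
  - apply: le_trans (ler_norm_sum _ _ _) _.
    rewrite -mulrA /kN mulr_natl -sumr_const; apply: ler_sum => k _; rewrite normrM.
    apply: ler_pM => //; case: ifP => _ //; by rewrite normr0.
  - rewrite normrM; apply: ler_pM => //; first exact: le_trans (coo_le _ _) _.
    by apply: Rm_lip => // k; apply: le_trans (w_le _ _) (le_trans _ rho1).
have [||z zr Tz] := @ball_contraction R #|K| rho T rho_gt0.
- move=> z z' zr z'r; apply: row_norm_le => [|l]; first by rewrite mulr_ge0 ?invr_ge0.
  rewrite !mxE /=; set k := enum_val l.
  have [c1 [c2 [FE c1_le c2_le]]] := lin z z' (inv k) zr z'r.
  set r := `|z - z'| in c1_le c2_le *.
  have r0 : 0 <= r by exact: normr_ge0.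
  have dz0 := cooB z z' k0; rewrite -/r in dz0.
  have Rb : `|Rm p (inv k) (w z)| <= L.
    by apply: Rm_bound => // k'; apply: le_trans (w_le _ _) (le_trans zr rho1).
  have Lr0 : 0 <= L * r by rewrite mulr_ge0.
  have c2' : `|c2| <= L * r by apply: le_trans c2_le _; rewrite ler_piMl.
  rewrite prK in FE; case: (eqVneq k k0) => [kk|kk].
    have nk : inv k = n0 by rewrite kk /k0 invK.
    rewrite nk eqxx add0r in FE; rewrite nk in Rb.
    have -> : coo z k - F z (inv k) / (eps * g) - (coo z' k - F z' (inv k) / (eps * g)) =
       (coo z k - coo z' k) * ((g - Rm p n0 (w z)) / g) - c1 / (eps * g) - c2 / g.
      transitivity ((coo z k - coo z' k) - (F z (inv k) - F z' (inv k)) / (eps * g)).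
        by ring.
      by rewrite nk kk FE; field; rewrite !gt_eqF.
    have gR : `|(g - Rm p n0 (w z)) / g| <= 8^-1.
      rewrite normrM normfV (gtr0_norm g_gt0) ler_pdivrMr //.
      have : `|Rm p n0 (w z) - Rm p n0 (fun=> 0)| <= L * rho.
        apply: Rm_lip (ltW rho_gt0) _ _ _ => // k'; rewrite ?normr0 //.
          by apply: le_trans (w_le _ _) (le_trans zr rho1).
        by rewrite subr0; apply: le_trans (w_le _ _) zr.
      move: Rp; rewrite !ler_norml => /andP[? ?] /andP[? ?]; apply/andP; split; lra.
    have t1 : `|(coo z k - coo z' k) * ((g - Rm p n0 (w z)) / g)| <= r * 8^-1.
      by rewrite normrM kk; apply: ler_pM.
    have t2 : `|c1 / (eps * g)| <= r * 8^-1.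
      rewrite normrM normfV (gtr0_norm eg0) ler_pdivrMr //.
      apply: le_trans c1_le _; move: e2; rewrite ler_pdivrMr //; nra.
    have t3 : `|c2 / g| <= r * 16^-1.
      rewrite normrM normfV (gtr0_norm g_gt0) ler_pdivrMr //.
      by apply: le_trans c2_le _; nra.
    move: t1 t2 t3; rewrite !ler_norml => /andP[? ?] /andP[? ?] /andP[? ?].
    by apply/andP; split; lra.
  have nk : inv k != n0 by apply: contraNneq kk => nk; rewrite /k0 -nk prK.
  rewrite (negbTE nk) in FE.
  have -> : coo z k - F z (inv k) - (coo z' k - F z' (inv k)) =
      - (c1 + eps * ((coo z k0 - coo z' k0) * Rm p (inv k) (w z) + c2)).
    transitivity ((coo z k - coo z' k) - (F z (inv k) - F z' (inv k))); first by ring.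
    by rewrite FE; ring.
  have t1 : `|eps * ((coo z k0 - coo z' k0) * Rm p (inv k) (w z) + c2)| <= 8^-1 * r.
    rewrite normrM gtr0_norm //; apply: (@le_trans _ _ (eps * (r * L + L * r))).
      rewrite ler_wpM2l ?(ltW eps_gt0) //; apply: le_trans (ler_normD _ _) _.
      by apply: lerD => //; rewrite normrM; apply: ler_pM.
    by rewrite (_ : _ * _ = eps * L * (2 * r)); [nra | ring].
  have t2 : `|c1| <= 8^-1 * r by nra.
  rewrite normrN; apply: le_trans (ler_normD _ _) _; lra.
- have F0 n : F 0 n = Q p n k0.
    have w0 k : w 0 k = 0 by rewrite /w /coo mxE mulr0 if_same.
    rewrite /F w0 mul0r addr0 (bigD1 k0) //= eqxx mulr1 big1 ?addr0 // => k /negbTE ->.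
    by rewrite w0 mulr0.
  apply: row_norm_le => [|l]; first by rewrite divr_ge0 // ltW.
  have Qk0 n : `|Q p n k0| <= eta.
    have := Qp n k0; rewrite /k0 (bij_eq pr_bij).
    by case: (eqVneq n n0) => /= _; rewrite subr0.
  rewrite mxE /= F0 /coo mxE; case: ifP => _; rewrite sub0r normrN.
    rewrite normrM normfV (gtr0_norm eg0); apply: le_trans e5.
    by rewrite ler_pM2r ?invr_gt0.
  exact: le_trans (Qk0 _) e4.
exists (w z); split => [k||n].
- exact: le_trans (w_le _ _) (le_trans zr rho1).
- rewrite /w eqxx normrM gtr0_norm // mulrA -(mulrC eps) eps16 mul1r.
  exact: le_trans (coo_le _ _) (le_trans zr rho1).
rewrite -/(F z n).
have := congr1 (fun v : 'rV[R]_#|K| => v 0 (enum_rank (pr n))) Tz.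
rewrite mxE /= enum_rankK invK -/(coo z (pr n)).
case: ifP => _ /eqP; rewrite -subr_eq0 addrAC subrr sub0r oppr_eq0.
  by rewrite mulf_eq0 invr_eq0 (gt_eqF eg0) orbF => /eqP.
by move=> /eqP.
Qed.

End PerturbedSystem.

(** * A second realization *)

Section ChainMove.
Variables (R : realType) (d i m : nat) (V : finType) (G : sgraph V).
Variable a : 'I_2 + 'I_(d - 1) -> V.
Hypothesis d_gt0 : (0 < d)%N.

Let H := @attachment 2 i m (d - 1) V G a.
Let U : finType := attach_vertex i m V.
Variable p : U -> 'rV[R]_d.
Hypothesis up : anchormx (card_ends d_gt0) (anchors a p) \in unitmx.

Definition end_beta (j : 'I_2) : 'cV[R]_(1 + d) := bary (card_ends d_gt0) (anchors a p) (inl j).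
Definition end_gamma (k : 'I_(d - 1)) : 'cV[R]_(1 + d) :=
  bary (card_ends d_gt0) (anchors a p) (inr k).

Let gb (j : 'I_2) := gradient (end_beta j).
Let gg (k : 'I_(d - 1)) := gradient (end_gamma k).

Variables (c : 'I_2 -> 'I_(d - 1) -> R) (kap : 'I_m -> 'I_2 -> R).

(** X2 moves by the affine map with linear part 1 + sum_jk c_jk (grad beta_j)
    (grad gamma_k), which fixes the flat of X4. Below, eq23 says that X3 moves by the
    affine map that fixes the line of X1 and whose linear part is the inverse
    transpose of this one. *)
Definition coef2 (y : 'I_i) (k : 'I_(d - 1)) :=
  \sum_j affine (end_beta j) (p (inr (inl y))) * c j k.

Definition move2 (y : 'I_i) : 'rV[R]_d := \sum_k coef2 y k *: gg k.

Definition move3 (z : 'I_m) : 'rV[R]_d := \sum_j kap z j *: gb j.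

Definition moved_config (u : U) : 'rV[R]_d :=
  match u with
  | inl v => p (inl v)
  | inr (inl y) => p (inr (inl y)) + move2 y
  | inr (inr z) => p (inr (inr z)) - move3 z
  end.

Hypothesis eq2 : forall y,
  2 * \sum_k coef2 y k * affine (end_gamma k) (p (inr (inl y))) + dot (move2 y) (move2 y) = 0.
Hypothesis eq3 : forall z,
  dot (move3 z) (move3 z) = 2 * \sum_j kap z j * affine (end_beta j) (p (inr (inr z))).
Hypothesis eq23 : forall z j,
  kap z j + \sum_j' (\sum_k c j k * dot (gb j') (gg k)) * kap z j' =
  \sum_k c j k * affine (end_gamma k) (p (inr (inr z))).

Let dot_move2 y e : dot e (move2 y) = \sum_k coef2 y k * dot e (gg k).
Proof. by rewrite dot_sumr; apply: eq_bigr => k _; rewrite dotZr. Qed.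

Let dot_move3 z e : dot e (move3 z) = \sum_j kap z j * dot e (gb j).
Proof. by rewrite dot_sumr; apply: eq_bigr => j _; rewrite dotZr. Qed.

Let sqdistD (s t e : 'rV[R]_d) : sqdist (s + e) t = sqdist s t + (2 * dot (s - t) e + dot e e).
Proof.
rewrite /sqdist addrAC; set r := s - t; clearbody r.
by rewrite dotDl !dotDr (dotC e r); ring.
Qed.

Let sq12 y j : sqdist (p (inr (inl y)) + move2 y) (p (inl (a (inl j)))) =
  sqdist (p (inr (inl y))) (p (inl (a (inl j)))).
Proof.
rewrite sqdistD dot_move2 (_ : \sum_k _ =
  \sum_k coef2 y k * affine (end_gamma k) (p (inr (inl y)))) ?eq2 ?addr0 //.
apply: eq_bigr => k _; rewrite -affineB; congr (_ * _).
by rewrite [X in _ - X](bary_anchor up (inr k) (inl j)) subr0.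
Qed.

Let sq34 z k : sqdist (p (inr (inr z)) - move3 z) (p (inl (a (inr k)))) =
  sqdist (p (inr (inr z))) (p (inl (a (inr k)))).
Proof.
rewrite sqdistD !(dotNl, dotNr) opprK eq3 dot_move3 (_ : \sum_j _ =
  \sum_j kap z j * affine (end_beta j) (p (inr (inr z)))).
  by rewrite mulrN addNr addr0.
apply: eq_bigr => j _; rewrite -affineB; congr (_ * _).
by rewrite [X in _ - X](bary_anchor up (inl j) (inr k)) subr0.
Qed.

(** By eq23, the product of the displacements of y and z cancels the mixed part of
    the first-order terms. *)
Let dot_move23 y z : dot (move2 y) (move3 z) =
  \sum_j affine (end_beta j) (p (inr (inl y))) *
    (\sum_k c j k * affine (end_gamma k) (p (inr (inr z))) - kap z j).
Proof.
rewrite dot_move3.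
transitivity (\sum_j' \sum_j affine (end_beta j) (p (inr (inl y))) *
   ((\sum_k c j k * dot (gb j') (gg k)) * kap z j')).
  apply: eq_bigr => j' _; rewrite dotC dot_move2 mulr_sumr.
  under eq_bigr => k _ do rewrite /coef2 mulr_suml mulr_sumr.
  rewrite exchange_big; apply: eq_bigr => j _ /=.
  by rewrite mulr_suml mulr_sumr; apply: eq_bigr => k _; ring.
rewrite exchange_big; apply: eq_bigr => j _ /=; rewrite -mulr_sumr -eq23.
by congr (_ * _); rewrite addrC addKr.
Qed.

Let sq23 y z : sqdist (p (inr (inl y)) + move2 y) (p (inr (inr z)) - move3 z) =
  sqdist (p (inr (inl y))) (p (inr (inr z))).
Proof.
rewrite (_ : sqdist _ _ = sqdist (p (inr (inl y)) + (move2 y + move3 z)) (p (inr (inr z)))).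
  rewrite sqdistD -[RHS]addr0; congr (_ + _).
  set r := p (inr (inl y)) - p (inr (inr z)).
  have rE : r = p (inr (inl y)) - p (inr (inr z)) by [].
  rewrite dotDr dotDl !dotDr (dotC (move3 z) (move2 y)) dot_move23.
  have -> : dot (move3 z) (move3 z) = 2 * \sum_j kap z j * affine (end_beta j) (p (inr (inr z))).
    exact: eq3.
  have -> : dot (move2 y) (move2 y) = 
      - (2 * \sum_k coef2 y k * affine (end_gamma k) (p (inr (inl y)))).
    by apply/eqP; rewrite -addr_eq0 addrC eq2.
  have -> : dot r (move3 z) = \sum_j kap z j * affine (end_beta j) (p (inr (inl y))) -
      \sum_j kap z j * affine (end_beta j) (p (inr (inr z))).
    rewrite dot_move3 -sumrB; apply: eq_bigr => j _.
    by rewrite -mulrBr affineB.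
  have -> : dot r (move2 y) = \sum_k coef2 y k * affine (end_gamma k) (p (inr (inl y))) -
      \sum_k coef2 y k * affine (end_gamma k) (p (inr (inr z))).
    rewrite dot_move2 -sumrB; apply: eq_bigr => k _.
    by rewrite -mulrBr affineB.
  have -> : \sum_k coef2 y k * affine (end_gamma k) (p (inr (inr z))) =
      \sum_j affine (end_beta j) (p (inr (inl y))) *
        \sum_k c j k * affine (end_gamma k) (p (inr (inr z))).
    under eq_bigr => k _ do rewrite /coef2 mulr_suml.
    rewrite exchange_big; apply: eq_bigr => j _ /=; rewrite mulr_sumr.
    by apply: eq_bigr => k _; rewrite mulrA.
  have -> : \sum_j affine (end_beta j) (p (inr (inl y))) *
        (\sum_k c j k * affine (end_gamma k) (p (inr (inr z))) - kap z j) =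
      \sum_j affine (end_beta j) (p (inr (inl y))) *
        (\sum_k c j k * affine (end_gamma k) (p (inr (inr z)))) -
      \sum_j affine (end_beta j) (p (inr (inl y))) * kap z j.
    by rewrite -sumrB; apply: eq_bigr => j _; rewrite mulrBr.
  have -> : \sum_j kap z j * affine (end_beta j) (p (inr (inl y))) =
      \sum_j affine (end_beta j) (p (inr (inl y))) * kap z j.
    by apply: eq_bigr => j _; rewrite mulrC.
  ring.
by rewrite /sqdist opprB !addrA.
Qed.

Lemma moved_config_equivalent : equivalent H p moved_config.
Proof.
have key t t' : chain_pair t t' ->
    sqdist (moved_config (sideA i a t)) (moved_config (sideB m a t')) =
    sqdist (p (sideA i a t)) (p (sideB m a t')).
  case: t t' => [j|z] [k|y] /= tt'; first by [].
  - by rewrite sqdistC sq12 sqdistC.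
  - exact: sq34.
  - by rewrite sqdistC sq23 sqdistC.
move=> u v /attach_adjP [[g [h [_ -> ->]]] //|[t [t' [tt' [[-> ->]|[-> ->]]]]]].
  by apply/eucl_dist_eqP/esym/key.
by apply/eucl_dist_eqP; rewrite -!/(sqdist _ _) sqdistC -key // sqdistC.
Qed.

Lemma moved_config_framework : framework moved_config.
Proof. exact: (framework_of_unit (e := fun k => inl (a (anchor _ k))) up). Qed.

(** A point of R^d is determined by its distances to the d + 1 anchors. *)
Lemma congruent_move2 : congruent p moved_config -> forall y, move2 y = 0.
Proof.
move=> cong y.
have dot_end b : 2 * dot (p (inr (inl y)) - anchors a p b) (move2 y) =
    - dot (move2 y) (move2 y).
  have := cong (inr (inl y)) (inl (a b)) => /eucl_dist_eqP.
  rewrite -!/(sqdist _ _) /= sqdistD => e.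
  apply/eqP; rewrite -addr_eq0; apply/eqP.
  by apply: (addrI (sqdist (p (inr (inl y))) (p (inl (a b))))); rewrite -e addr0.
apply: (@affine_at_inj _ _ (anchors a p (inl 0))); apply: (affine_eq0 up) => k.
rewrite affine_atE; apply: (@mulfI _ 2); first by rewrite pnatr_eq0.
have := dot_end (anchor (card_ends d_gt0) k); have := dot_end (inl 0).
by rewrite !dotBl; lra.
Qed.

End ChainMove.

Section Tame.
Variables (R : realType) (K P : Type) (good : P -> Prop).
Implicit Types F G : P -> (K -> R) -> R.

(** The property of the remainders in [perturbed_system_solution] that is stable
    under the ring operations: a bound and a Lipschitz constant on the unit cube,
    both uniform in the parameter p. *)
Definition tame F : Prop := exists2 C : R, 0 <= C &
  forall p w, good p -> (forall k, `|w k| <= 1) -> `|F p w| <= C /\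
    forall w' r, 0 <= r -> (forall k, `|w' k| <= 1) ->
      (forall k, `|w k - w' k| <= r) -> `|F p w - F p w'| <= C * r.

Lemma tame_param (f : P -> R) (M : R) :
  (forall p, good p -> `|f p| <= M) -> tame (fun p _ => f p).
Proof.
move=> fM; exists `|M| => // p w gp _; split=> [|w' r r0 _ _].
  exact: le_trans (fM p gp) (ler_norm M).
by rewrite subrr normr0 mulr_ge0.
Qed.

Lemma tame_cst (c : R) : tame (fun _ _ => c).
Proof. exact: (@tame_param (fun=> c) `|c|). Qed.

Lemma tame_var k : tame (fun _ w => w k).
Proof. by exists 1 => // p w gp w1; split => [//|w' r r0 _ wr]; rewrite mul1r. Qed.

Lemma tameD F G : tame F -> tame G -> tame (fun p w => F p w + G p w).
Proof.
move=> [C C0 FC] [D D0 GD]; exists (C + D); first exact: addr_ge0.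
move=> p w gp w1; have [Fw Fw'] := FC p w gp w1; have [Gw Gw'] := GD p w gp w1.
split=> [|w' r r0 w'1 ww'].
  by apply: le_trans (ler_normD _ _) _; apply: lerD.
rewrite opprD addrACA mulrDl; apply: le_trans (ler_normD _ _) _.
by apply: lerD; [exact: Fw' | exact: Gw'].
Qed.

Lemma tameM F G : tame F -> tame G -> tame (fun p w => F p w * G p w).
Proof.
move=> [C C0 FC] [D D0 GD]; exists (2 * (C * D)); first by rewrite !mulr_ge0.
have CD0 : 0 <= C * D by rewrite mulr_ge0.
move=> p w gp w1; have [Fw Fw'] := FC p w gp w1; have [Gw Gw'] := GD p w gp w1.
split=> [|w' r r0 w'1 ww'].
  by rewrite normrM; apply: (le_trans (ler_pM _ _ Fw Gw)) => //; lra.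
have [Fw1 _] := FC p w' gp w'1.
have -> : F p w * G p w - F p w' * G p w' =
    (F p w - F p w') * G p w + F p w' * (G p w - G p w') by ring.
apply: le_trans (ler_normD _ _) _; rewrite !normrM.
have h1 : `|F p w - F p w'| * `|G p w| <= C * r * D by apply: ler_pM => //; exact: Fw'.
have h2 : `|F p w'| * `|G p w - G p w'| <= C * (D * r) by apply: ler_pM => //; exact: Gw'.
by apply: le_trans (lerD h1 h2) _; rewrite (_ : C * r * D + _ = 2 * (C * D) * r) //; ring.
Qed.

Lemma tame_sum (J : finType) (F : J -> P -> (K -> R) -> R) :
  (forall j, tame (F j)) -> tame (fun p w => \sum_j F j p w).
Proof.
move=> tF; elim: (index_enum J) => [|j r IH].
  rewrite (_ : (fun p w => _) = fun _ _ => 0); first exact: tame_cst.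
  by apply/funext => p; apply/funext => w; rewrite big_nil.
rewrite (_ : (fun p w => _) = fun p w => F j p w + \sum_(j <- r) F j p w).
  exact: tameD.
by apply/funext => p; apply/funext => w; rewrite big_cons.
Qed.

End Tame.

Section PolynomialContinuity.
Variables (R : realType) (I : finType).
Implicit Types (x : I -> R) (F : (I -> R) -> R).

Definition box x0 : set_system (I -> R) :=
  filter_from [set e : R | 0 < e] (fun e => [set x | forall i, `|x i - x0 i| < e]).

Global Instance box_filter x0 : Filter (box x0).
Proof.
apply: filter_from_filter; first by exists 1 => /=; exact: ltr01.
move=> e e' /= e0 e'0; exists (Num.min e e'); first by rewrite /= lt_min e0.
by move=> x /= xe; split=> i; have := xe i; rewrite lt_min => /andP[].
Qed.

Lemma polyfun_cvg F x0 : polyfun F -> F x @[x --> box x0] --> F x0.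
Proof.
move=> [Q QE]; rewrite (_ : F = fun x => mpoly.mmap (intr : int -> R)
    (fun j => x (enum_val j)) Q); last exact/funext.
rewrite /mpoly.mmap; elim: (mpoly.msupp Q) => [|m r IH].
  rewrite big_nil (_ : (fun x => _) = fun=> 0); first exact: cvg_cst.
  by apply/funext => x; rewrite big_nil.
rewrite big_cons (_ : (fun x => _) = fun x => (mpoly.mcoeff m Q)%:~R *
  mpoly.mmap1 (fun j => x (enum_val j)) m + \sum_(m <- r) (mpoly.mcoeff m Q)%:~R *
  mpoly.mmap1 (fun j => x (enum_val j)) m); last first.
  by apply/funext => x; rewrite big_cons.
apply: cvgD IH; apply: cvgM; first exact: cvg_cst.
rewrite /mpoly.mmap1; elim: (index_enum _) => [|j s IH].
  rewrite big_nil (_ : (fun x => _) = fun=> 1); first exact: cvg_cst.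
  by apply/funext => x; rewrite big_nil.
rewrite big_cons (_ : (fun x => _) = fun x => x (enum_val j) ^+ m j *
  \prod_(j <- s) x (enum_val j) ^+ m j); last first.
  by apply/funext => x; rewrite big_cons.
apply: cvgM IH; elim: (m j) => [|n IH].
  by rewrite expr0; apply: cvg_cst.
rewrite exprS (_ : (fun x => _) = fun x => x (enum_val j) * x (enum_val j) ^+ n); last first.
  by apply/funext => x; rewrite exprS.
apply: cvgM IH; apply/cvgrPdist_lt => e e0; exists e => //= x xe.
by rewrite distrC; exact: xe.
Qed.

Lemma ratfun_near F D x0 (e : R) : polyfun F -> polyfun D -> D x0 != 0 -> 0 < e ->
  \forall x \near box x0, `|(D x)^-1 * F x - (D x0)^-1 * F x0| < e.
Proof.
move=> pF pD D0 e0.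
have : (D x)^-1 * F x @[x --> box x0] --> (D x0)^-1 * F x0.
  by apply: cvgM; [apply: cvgV => // |]; exact: polyfun_cvg.
by move=> /cvgrPdist_lt/(_ e e0); apply: filterS => x; rewrite distrC.
Qed.

End PolynomialContinuity.

Section SecondRealization.
Variables (R : realType) (d i m : nat) (V : finType).
Variable a : 'I_2 + 'I_(d - 1) -> V.
Hypothesis d_gt0 : (0 < d)%N.

Let N : finType := ('I_i + 'I_m)%type.
Let K : finType := ('I_2 * 'I_(d - 1))%type.
Let U : finType := (V + N)%type.
Implicit Types (p : U -> 'rV[R]_d) (w : K -> R).

Variable k0 : K.

Let be p j n := affine (end_beta a d_gt0 p j) (p (inr n)).
Let ga p k n := affine (end_gamma a d_gt0 p k) (p (inr n)).
Let gb p j := gradient (end_beta a d_gt0 p j).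
Let gg p k := gradient (end_gamma a d_gt0 p k).

(** The coefficients of the moves are s zeta, where s = w k0 is the scale, and
    where the entry of zeta with index k0 is normalised to 1. *)
Definition zeta w (j : 'I_2) (k : 'I_(d - 1)) : R := if (j, k) == k0 then 1 else w (j, k).

(** The displacement of z in X3 is - sum_j kappa_j (grad beta_j), where (1 + s
    cross_form) kappa = s slope3. By Cramer's rule kappa = s num3 / det3, with
    num3 = slope3 + s corr3 and det3 = 1 + s det3_rest. *)
Definition cross_form p w (j j' : 'I_2) : R := \sum_k zeta w j k * dot (gb p j') (gg p k).

Definition slope3 p w (z : 'I_m) (j : 'I_2) : R := \sum_k zeta w j k * ga p k (inr z).

Definition corr3 p w (z : 'I_m) (j : 'I_2) : R :=
  if j == 0 then cross_form p w 1 1 * slope3 p w z 0 - cross_form p w 0 1 * slope3 p w z 1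
  else cross_form p w 0 0 * slope3 p w z 1 - cross_form p w 1 0 * slope3 p w z 0.

Definition num3 p w (z : 'I_m) (j : 'I_2) : R := slope3 p w z j + w k0 * corr3 p w z j.

Definition det3_rest p w : R := cross_form p w 0 0 + cross_form p w 1 1 +
  w k0 * (cross_form p w 0 0 * cross_form p w 1 1 - cross_form p w 0 1 * cross_form p w 1 0).

Definition det3 p w : R := 1 + w k0 * det3_rest p w.

Definition dir2 p w (y : 'I_i) : 'rV[R]_d :=
  \sum_k (\sum_j be p j (inl y) * zeta w j k) *: gg p k.

Definition dir3 p w (z : 'I_m) : 'rV[R]_d := \sum_j num3 p w z j *: gb p j.

(** In the equations on c = s zeta that make the moved framework equivalent, the
    scale can be factored out. What is left is first_order zeta + s second_order =
    0: it is 2 / s times the equation of a point of X2, and - 2 det3^2 / s times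
    that of a point of X3. *)
Definition second_order p (n : N) w : R :=
  match n with
  | inl y => 2 * dot (dir2 p w y) (dir2 p w y)
  | inr z => 4 * (\sum_j be p j (inr z) * slope3 p w z j) * det3_rest p w +
      4 * (\sum_j be p j (inr z) * corr3 p w z j) * det3 p w -
      2 * dot (dir3 p w z) (dir3 p w z)
  end.

Definition first_order p (n : N) (k : K) : R := 4 * (be p k.1 n * ga p k.2 n).

Lemma first_orderE p n w :
  \sum_k first_order p n k * (if k == k0 then 1 else w k) =
  4 * \sum_j \sum_k be p j n * (zeta w j k * ga p k n).
Proof.
rewrite pair_big mulr_sumr; apply: eq_bigr => -[j k] _ /=.
rewrite /first_order /zeta /= -!mulrA; congr (_ * (_ * _)).
by rewrite mulrC.
Qed.

Lemma system_moves p w : det3 p w != 0 ->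
  (forall n, \sum_k first_order p n k * (if k == k0 then 1 else w k) +
     w k0 * second_order p n w = 0) ->
  let c (j : 'I_2) (k : 'I_(d - 1)) := w k0 * zeta w j k in
  let kap (z : 'I_m) (j : 'I_2) := w k0 / det3 p w * num3 p w z j in
  [/\ forall y, 2 * \sum_k coef2 a d_gt0 p c y k *
        affine (end_gamma a d_gt0 p k) (p (inr (inl y))) +
        dot (move2 a d_gt0 p c y) (move2 a d_gt0 p c y) = 0,
      forall z, dot (move3 a d_gt0 p kap z) (move3 a d_gt0 p kap z) =
        2 * \sum_j kap z j * affine (end_beta a d_gt0 p j) (p (inr (inr z))) &
      forall z j, kap z j +
        \sum_j' (\sum_k c j k * dot (gb p j') (gg p k)) * kap z j' =
        \sum_k c j k * affine (end_gamma a d_gt0 p k) (p (inr (inr z)))].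
Proof.
move=> d0 sol c kap; set s := w k0.
have quadE n : 4 * \sum_j \sum_k be p j n * (zeta w j k * ga p k n) =
    - (s * second_order p n w).
  by apply/eqP; rewrite -addr_eq0 -first_orderE sol.
split=> [y|z|z j].
- have coefE k : coef2 a d_gt0 p c y k = s * \sum_j be p j (inl y) * zeta w j k.
    by rewrite mulr_sumr; apply: eq_bigr => j _; rewrite /c -/s mulrCA.
  have moveE : move2 a d_gt0 p c y = s *: dir2 p w y.
    by rewrite scaler_sumr; apply: eq_bigr => k _; rewrite coefE scalerA.
  rewrite moveE dotZl dotZr.
  have -> : \sum_k coef2 a d_gt0 p c y k *
      affine (end_gamma a d_gt0 p k) (p (inr (inl y))) =
      s * \sum_j \sum_k be p j (inl y) * (zeta w j k * ga p k (inl y)).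
    rewrite exchange_big mulr_sumr; apply: eq_bigr => k _.
    rewrite coefE -mulrA mulr_suml; congr (_ * _).
    by apply: eq_bigr => j _; rewrite mulrA.
  by have := quadE (inl y); rewrite /second_order => e; nra.
- have moveE : move3 a d_gt0 p kap z = (s / det3 p w) *: dir3 p w z.
    by rewrite scaler_sumr; apply: eq_bigr => j _; rewrite scalerA.
  rewrite moveE dotZl dotZr.
  have -> : \sum_j kap z j * affine (end_beta a d_gt0 p j) (p (inr (inr z))) =
      s / det3 p w * \sum_j be p j (inr z) * num3 p w z j.
    by rewrite mulr_sumr; apply: eq_bigr => j _; rewrite /kap -/s -mulrA (mulrC (num3 _ _ _ _)).
  have muE : \sum_j be p j (inr z) * num3 p w z j =
     \sum_j be p j (inr z) * slope3 p w z j + s * \sum_j be p j (inr z) * corr3 p w z j.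
    rewrite mulr_sumr -big_split; apply: eq_bigr => j _.
    by rewrite /num3 mulrDr mulrCA.
  have tauE : \sum_j \sum_k be p j (inr z) * (zeta w j k * ga p k (inr z)) =
      \sum_j be p j (inr z) * slope3 p w z j.
    by apply: eq_bigr => j _; rewrite mulr_sumr.
  have := quadE (inr z); rewrite tauE /second_order.
  move: muE; set A := \sum_j _ * slope3 _ _ _ _; set B := \sum_j _ * corr3 _ _ _ _.
  set D := dot _ _ => muE e.
  have sD : s * D = 2 * (det3 p w * (A + s * B)).
    move: e; rewrite /det3 -/s; set dd := det3_rest p w; lra.
  rewrite muE (_ : s / det3 p w * (s / det3 p w * D) =
    s / det3 p w * (s * D) / det3 p w); last by ring.
  by rewrite sD; field.
- have sumE : \sum_k c j k * affine (end_gamma a d_gt0 p k) (p (inr (inr z))) =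
      s * slope3 p w z j.
    by rewrite mulr_sumr; apply: eq_bigr => k _; rewrite mulrA.
  have crossE j' : \sum_k c j k * dot (gb p j') (gg p k) = s * cross_form p w j j'.
    by rewrite mulr_sumr; apply: eq_bigr => k _; rewrite mulrA.
  rewrite sumE; under eq_bigr => j' _ do rewrite crossE.
  rewrite sum_ord2 /kap -/s /num3 /corr3 /=.
  move: d0; rewrite /det3 /det3_rest -/s.
  case: (unliftP 0 j) => [j1 ->|->] d0.
    have -> : lift 0 j1 = 1 :> 'I_2 by apply/val_inj; rewrite /= (ord1 j1).
    by rewrite /=; field.
  by rewrite /=; field.
Qed.

End SecondRealization.

Section TameSecondOrder.
Variables (R : realType) (d i m : nat) (V : finType).
Variable a : 'I_2 + 'I_(d - 1) -> V.
Hypothesis d_gt0 : (0 < d)%N.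

Let N : finType := ('I_i + 'I_m)%type.
Let K : finType := ('I_2 * 'I_(d - 1))%type.
Let U : finType := (V + N)%type.
Variables (k0 : K) (M : R).

(** All quantities of the system are polynomials in w, in the barycentric
    coordinates of the points and in their gradients, so that bounds on the latter
    are sufficient. *)
Definition bounded_bary (p : U -> 'rV[R]_d) : Prop :=
  (forall b n, `|affine (bary (card_ends d_gt0) (anchors a p) b) (p (inr n))| <= M) /\
  (forall b l, `|gradient (bary (card_ends d_gt0) (anchors a p) b) 0 l| <= M).

Local Notation tm := (@tame R K (U -> 'rV[R]_d) bounded_bary).

Let tame_bary b n :
  tm (fun p _ => affine (bary (card_ends d_gt0) (anchors a p) b) (p (inr n))).
Proof. by apply: tame_param => p [h _]; exact: h. Qed.

Let tame_grad b l :
  tm (fun p _ => gradient (bary (card_ends d_gt0) (anchors a p) b) 0 l).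
Proof. by apply: tame_param => p [_ h]; exact: h. Qed.

Let tame_zeta j k : tm (fun _ w => zeta k0 w j k).
Proof.
by rewrite /zeta; case: (_ == k0); [exact: tame_cst | exact: tame_var].
Qed.

Let tame_cross_form j j' : tm (fun p w => cross_form a d_gt0 k0 p w j j').
Proof.
rewrite /cross_form /dot; apply: tame_sum => k; apply: tameM; first exact: tame_zeta.
by apply: tame_sum => l; apply: tameM; exact: tame_grad.
Qed.

Let tame_slope3 z j : tm (fun p w => slope3 a d_gt0 k0 p w z j).
Proof.
rewrite /slope3; apply: tame_sum => k.
by apply: tameM; [exact: tame_zeta | exact: tame_bary].
Qed.

Let tameB F G : tm F -> tm G -> tm (fun p w => F p w - G p w).
Proof.
move=> tF tG; have := tameD tF (tameM (@tame_cst R K _ _ (-1)) tG).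
rewrite (_ : (fun p w => F p w + _) = fun p w => F p w - G p w) //.
by apply/funext => p; apply/funext => w; rewrite mulN1r.
Qed.

Let tame_corr3 z j : tm (fun p w => corr3 a d_gt0 k0 p w z j).
Proof.
by rewrite /corr3; case: (j == 0); apply: tameB; apply: tameM;
  first [exact: tame_cross_form | exact: tame_slope3].
Qed.

Lemma tame_det3_rest : tm (fun p w => det3_rest a d_gt0 k0 p w).
Proof.
rewrite /det3_rest; apply: tameD; first by apply: tameD; exact: tame_cross_form.
by apply: tameM; [exact: tame_var | apply: tameB; apply: tameM; exact: tame_cross_form].
Qed.

Let tame_sqnorm (D : (U -> 'rV[R]_d) -> (K -> R) -> 'rV[R]_d) :
  (forall l, tm (fun p w => D p w 0 l)) -> tm (fun p w => dot (D p w) (D p w)).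
Proof. by move=> tD; rewrite /dot; apply: tame_sum => l; apply: tameM; exact: tD. Qed.

Let tame_comb (J : finType) (F : J -> (U -> 'rV[R]_d) -> (K -> R) -> R)
    (b : J -> 'I_2 + 'I_(d - 1)) l : (forall j, tm (F j)) ->
  tm (fun p w => (\sum_j F j p w *:
    gradient (bary (card_ends d_gt0) (anchors a p) (b j))) 0 l).
Proof.
move=> tF; rewrite (_ : (fun p w => _) = fun p w =>
  \sum_j F j p w * gradient (bary (card_ends d_gt0) (anchors a p) (b j)) 0 l).
  by apply: tame_sum => j; apply: tameM; [exact: tF | exact: tame_grad].
apply/funext => p; apply/funext => w; rewrite summxE.
by apply: eq_bigr => j _; rewrite mxE.
Qed.

Lemma tame_second_order n : tm (fun p w => second_order a d_gt0 k0 p n w).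
Proof.
case: n => [y|z] /=.
  apply: tameM; first exact: tame_cst.
  apply: tame_sqnorm => l; apply: (@tame_comb _ _ (fun k => inr k) l) => k.
  by apply: tame_sum => j; apply: tameM; [exact: tame_bary | exact: tame_zeta].
apply: tameB; first apply: tameD.
- apply: tameM; last exact: tame_det3_rest.
  apply: tameM; first exact: tame_cst.
  by apply: tame_sum => j; apply: tameM; [exact: tame_bary | exact: tame_slope3].
- apply: tameM; last first.
    apply: tameD; first exact: tame_cst.
    by apply: tameM; [exact: tame_var | exact: tame_det3_rest].
  apply: tameM; first exact: tame_cst.
  by apply: tame_sum => j; apply: tameM; [exact: tame_bary | exact: tame_corr3].
- apply: tameM; first exact: tame_cst.
  apply: tame_sqnorm => l; apply: (@tame_comb _ _ (fun j => inl j) l) => j.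
  apply: tameD; first exact: tame_slope3.
  by apply: tameM; [exact: tame_var | exact: tame_corr3].
Qed.

Lemma second_order_bound : exists2 L : R, 0 <= L &
  (forall p w, bounded_bary p -> (forall k, `|w k| <= 1) ->
     `|det3_rest a d_gt0 k0 p w| <= L) /\
  (forall p n w, bounded_bary p -> (forall k, `|w k| <= 1) ->
     `|second_order a d_gt0 k0 p n w| <= L /\
     forall w' r, 0 <= r -> (forall k, `|w' k| <= 1) ->
      (forall k, `|w k - w' k| <= r) ->
      `|second_order a d_gt0 k0 p n w - second_order a d_gt0 k0 p n w'| <= L * r).
Proof.
have [C C0 dC] := tame_det3_rest.
have /choice[f fP] : forall n, exists C : R, 0 <= C /\ forall p w, bounded_bary p ->
   (forall k, `|w k| <= 1) -> `|second_order a d_gt0 k0 p n w| <= C /\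
    forall w' r, 0 <= r -> (forall k, `|w' k| <= 1) ->
      (forall k, `|w k - w' k| <= r) ->
      `|second_order a d_gt0 k0 p n w - second_order a d_gt0 k0 p n w'| <= C * r.
  by move=> n; have [D D0 nD] := tame_second_order n; exists D.
have f0 : 0 <= \sum_n f n by apply: sumr_ge0 => n _; have [] := fP n.
have fle n : f n <= C + \sum_n f n.
  rewrite (bigD1 n) //= addrCA lerDl addr_ge0 // sumr_ge0 // => n' _.
  by have [] := fP n'.
exists (C + \sum_n f n); first exact: addr_ge0.
split=> [p w bp w1|p n w bp w1].
  by have [h _] := dC p w bp w1; apply: le_trans h _; rewrite lerDl.
have [_ /(_ p w bp w1)[h1 h2]] := fP n; split; first exact: le_trans h1 (fle n).
move=> w' r r0 w'1 ww'; apply: le_trans (h2 w' r r0 w'1 ww') _.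
by rewrite ler_wpM2r.
Qed.

End TameSecondOrder.

Section BarycentricFractions.
Variables (R : realType) (d : nat) (V N : finType) (n1 n2 : nat).
Variable a : 'I_n1 + 'I_n2 -> V.
Hypothesis cardB : #|('I_n1 + 'I_n2 : finType)%type| = (1 + d)%N.
Let U : finType := (V + N)%type.
Implicit Types (x : U * 'I_d -> R) (p : U -> 'rV[R]_d).

(** Near a configuration in general position, the barycentric coordinates are
    quotients of polynomial functions, and so they are continuous. *)
Definition bary_den x : R := \det (anchormx cardB (anchors a (config_of x))).

Definition bary_num b n x : R := (hat (config_of x (inr n)) *m
  \adj (anchormx cardB (anchors a (config_of x)))) 0 (anchor_rank cardB b).

Definition grad_num b l x : R :=
  \adj (anchormx cardB (anchors a (config_of x))) (rshift 1 l) (anchor_rank cardB b).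

Lemma polyfun_bary_den : polyfun bary_den.
Proof. exact/polyfun_det/polymx_hatmx. Qed.

Lemma polyfun_bary_num b n : polyfun (bary_num b n).
Proof.
by apply: polymx_mul; [exact: polymx_hat | exact/polymx_adj/polymx_hatmx].
Qed.

Lemma polyfun_grad_num b l : polyfun (grad_num b l).
Proof. exact/polymx_adj/polymx_hatmx. Qed.

Variable p : U -> 'rV[R]_d.
Hypothesis up : anchormx cardB (anchors a p) \in unitmx.

Lemma bary_den_neq0 : bary_den (coords p) != 0.
Proof. by rewrite /bary_den coordsK -unitfE -unitmxE. Qed.

Lemma bary_fraction b n : affine (bary cardB (anchors a p) b) (p (inr n)) =
  (bary_den (coords p))^-1 * bary_num b n (coords p).
Proof.
have := bary_den_neq0; rewrite /bary_num /bary_den coordsK => den0.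
by rewrite affine_bary_adj // mulrA mulVf ?mul1r.
Qed.

Lemma grad_fraction b l : gradient (bary cardB (anchors a p) b) 0 l =
  (bary_den (coords p))^-1 * grad_num b l (coords p).
Proof.
rewrite /grad_num /bary_den coordsK /gradient /bary.
by rewrite [LHS]mxE [LHS]mxE [LHS]mxE /invmx up [LHS]mxE.
Qed.

End BarycentricFractions.

Section NotGloballyRigid.
Variables (R : realType) (d i m : nat) (V : finType) (G : sgraph V).
Variable a : 'I_2 + 'I_(d - 1) -> V.
Hypothesis a_inj : injective a.
Hypotheses (i_gt2 : (2 < i)%N) (i_ltd : (i < d - 1)%N).
Hypothesis im : (i + m = 2 * (d - 1))%N.

Let H := @attachment 2 i m (d - 1) V G a.
Let N : finType := ('I_i + 'I_m)%type.
Let K : finType := ('I_2 * 'I_(d - 1))%type.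
Let U : finType := (V + N)%type.

Let d_gt0 : (0 < d)%N. Proof. by case: d i_ltd. Qed.
Let d1_gt0 : (0 < d - 1)%N. Proof. exact: leq_ltn_trans i_ltd. Qed.
Let i_gt0 : (0 < i)%N. Proof. exact: leq_ltn_trans i_gt2. Qed.

Let k0 : K := (0, Ordinal d1_gt0).
Let y0 : 'I_i := Ordinal i_gt0.
Let n0 : N := inl y0.
Let cardB := card_ends d_gt0.

Let second_order_at0 (p : U -> 'rV[R]_d) :
  second_order a d_gt0 k0 p n0 (fun=> 0) =
  2 * (affine (bary cardB (anchors a p) (inl 0)) (p (inr n0)) ^+ 2 *
   \sum_l gradient (bary cardB (anchors a p) (inr k0.2)) 0 l ^+ 2).
Proof.
rewrite /= (_ : dir2 _ _ _ _ _ _ = affine (bary cardB (anchors a p) (inl 0)) (p (inr n0)) *: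
   gradient (bary cardB (anchors a p) (inr k0.2))).
  rewrite dotZl dotZr; congr (_ * _); by rewrite mulrA -expr2; congr (_ * _).
rewrite /dir2 (bigD1 k0.2) //= [X in _ + X]big1 ?addr0 => [|k kk].
  rewrite sum_ord2 /zeta /k0 !xpair_eqE !eqxx /= mulr1 mulr0 addr0 //.
rewrite big1 ?scale0r // => j _; rewrite /zeta /k0 xpair_eqE /= (negbTE kk) andbF mulr0 //.
Qed.

(** At the special configuration p0, the point of X2 + X3 that is paired with (j,
    k) is halfway between the anchors j and k, except that the point n0 of X2
    paired with k0 is put on an anchor of X1. There all products beta_j gamma_k
    vanish, and the matrix of the first-order part is the identity with its row n0
    replaced by 0. The remainder of equation n0 is a positive multiple g of a
    square norm, so [perturbed_system_solution] applies to all configurations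
    close to p0, and in particular to a generic one. *)
Theorem attachment_not_globally_rigid : ~ generically_globally_rigid R d H.
Proof.
have cardN : #|N| = (2 * (d - 1))%N by rewrite card_sum !card_ord.
have d_lt : (d < d - 1 + i)%N by lia.
have [pr prb prn0] := @exists_pairing N 2 (d - 1) cardN n0 k0.
pose h n : 'rV[R]_d := if n == n0 then simplex R (anchor_rank cardB (inl 0))
  else simplex_mid R cardB (inl (pr n).1) (inr (pr n).2).
pose p0 : U -> 'rV[R]_d := simplex_config a cardB h.
have up0 : anchormx cardB (anchors a p0) \in unitmx by exact: anchormx_simplex_unit.
have bary0 b : affine (bary cardB (anchors a p0) b) (p0 (inr n0)) = (b == inl 0)%:R.
  rewrite [p0 (inr n0)]/(h n0) /h eqxx -(anchors_simplex a_inj cardB h).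
  by rewrite (bary_anchor up0).
have baryN n b : n != n0 -> affine (bary cardB (anchors a p0) b) (p0 (inr n)) =
    2^-1 * ((b == inl (pr n).1)%:R + (b == inr (pr n).2)%:R).
  move=> /negbTE nn; rewrite [p0 (inr n)]/(h n) /h nn (affine_simplex_mid a_inj cardB h).
  by rewrite !(bary_anchor up0).
have first0 n k : first_order a d_gt0 p0 n k = ((n != n0) && (pr n == k))%:R.
  rewrite /first_order /end_beta /end_gamma.
  have [->|nn] := eqVneq n n0; first by rewrite !bary0 /= !mulr0.
  rewrite !baryN //; case: k (pr n) => [j k] [j' k'] /=.
  have ell (l l' : 'I_2) : (inl l == inl l' :> 'I_2 + 'I_(d - 1)) = (l == l') by [].
  have err (l l' : 'I_(d - 1)) : (inr l == inr l' :> 'I_2 + 'I_(d - 1)) = (l == l') by [].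
  rewrite !ell !err xpair_eqE (eq_sym j) (eq_sym k) addr0 add0r.
  by case: (j' == j); case: (k' == k); rewrite /= ?(mulr0, mul0r, mulr1) //; field.
pose g := second_order a d_gt0 k0 p0 n0 (fun=> 0).
have g_gt0 : 0 < g.
  rewrite /g second_order_at0 bary0 eqxx expr1n mul1r mulr_gt0 //.
  rewrite lt_neqAle eq_sym; apply/andP; split; last first.
    by apply: sumr_ge0 => l _; rewrite sqr_ge0.
  set v := gradient _; apply/negP => v0.
  have vv0 : dot v v = 0.
    by rewrite -[RHS](eqP v0); apply: eq_bigr => l _; rewrite expr2.
  have v00 : v = 0 by apply/eqP; rewrite -dot_eq0 vv0.
  have := affineB (bary cardB (anchors a p0) (inr k0.2))
    (anchors a p0 (inr k0.2)) (anchors a p0 (inl 0)).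
  rewrite -/v v00 !(bary_anchor up0) eqxx dotC dot0l subr0 => /eqP.
  by rewrite oner_eq0.
(* Bounds that still hold near p0, where each quantity differs by less than 1. *)
pose M := \sum_b (\sum_n `|affine (bary cardB (anchors a p0) b) (p0 (inr n))| +
  \sum_l `|gradient (bary cardB (anchors a p0) b) 0 l|) + 1.
have M_bary b n : `|affine (bary cardB (anchors a p0) b) (p0 (inr n))| + 1 <= M.
  rewrite /M lerD2r (bigD1 b) //= (bigD1 n) //= -!addrA lerDl.
  rewrite !addr_ge0 ?sumr_ge0 // => b' _.
  by rewrite addr_ge0 ?sumr_ge0.
have M_grad b l : `|gradient (bary cardB (anchors a p0) b) 0 l| + 1 <= M.
  rewrite /M lerD2r (bigD1 b) //= [X in _ + X + _](bigD1 l) //=.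
  rewrite [X in _ <= X + _]addrCA -!addrA lerDl.
  rewrite !addr_ge0 ?sumr_ge0 // => b' _.
  by rewrite addr_ge0 ?sumr_ge0.
have [L L0 [deltaL secondL]] := @second_order_bound R d i m V a d_gt0 k0 M.
have [||eta eta0 solve] := @perturbed_system_solution R K N pr n0 prb _
  (@bounded_bary R d i m V a d_gt0 M) (fun p => first_order a d_gt0 p)
  (second_order a d_gt0 k0) g L g_gt0 L0.
- by move=> p n w gp w1; have [] := secondL p n w gp w1.
- by move=> p n w w' r gp r0 w1 w'1 ww'; have [_] := secondL p n w gp w1; apply.
rewrite prn0 in solve.
pose x0 := coords p0.
pose D := @bary_den R d V N _ _ a cardB.
pose F := @bary_num R d V N _ _ a cardB.
pose Gr := @grad_num R d V N _ _ a cardB.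
have pD : polyfun D by exact: polyfun_bary_den.
have pF b n : polyfun (F b n) by exact: polyfun_bary_num.
have pG b l : polyfun (Gr b l) by exact: polyfun_grad_num.
have D0 : D x0 != 0 by exact: bary_den_neq0.
pose F1 n (k : K) x := 4 * (F (inl k.1) n x * F (inr k.2) n x).
have pF1 n k : polyfun (F1 n k).
  by apply: polyfunM; [exact: (polyfun_int _ _ 4) | exact: polyfunM].
pose F2 x := 2 * ((F (inl 0) n0 x * F (inl 0) n0 x) *
  \sum_l Gr (inr k0.2) l x * Gr (inr k0.2) l x).
have pF2 : polyfun F2.
  apply: polyfunM; first exact: (polyfun_int _ _ 2).
  by apply: polyfunM; [exact: polyfunM | apply: polyfun_sum => l; exact: polyfunM].
have first_frac (p : U -> 'rV[R]_d) n k : anchormx cardB (anchors a p) \in unitmx ->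
    first_order a d_gt0 p n k =
    (D (coords p) * D (coords p))^-1 * F1 n k (coords p).
  move=> up; rewrite /first_order /end_beta /end_gamma !bary_fraction //.
  have frac (D' f f' : R) : D' != 0 ->
      4 * (D'^-1 * f * (D'^-1 * f')) = (D' * D')^-1 * (4 * (f * f')).
    by move=> D'0; field.
  exact: frac (bary_den_neq0 up).
have second_frac (p : U -> 'rV[R]_d) : anchormx cardB (anchors a p) \in unitmx ->
    second_order a d_gt0 k0 p n0 (fun=> 0) =
    (D (coords p) * D (coords p) * (D (coords p) * D (coords p)))^-1 * F2 (coords p).
  move=> up; rewrite second_order_at0 bary_fraction //.
  have := bary_den_neq0 up; rewrite -/(D _) => den0.
  have frac (D' f S : R) : D' != 0 -> 2 * ((D'^-1 * f) ^+ 2 * ((D' * D')^-1 * S)) =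
      (D' * D' * (D' * D'))^-1 * (2 * (f * f * S)).
    by move=> D'0; field.
  have frac1 (D' f : R) : D' != 0 -> (D'^-1 * f) ^+ 2 = (D' * D')^-1 * (f * f).
    by move=> D'0; field.
  rewrite (_ : \sum_l _ = (D (coords p) * D (coords p))^-1 *
      \sum_l Gr (inr k0.2) l (coords p) * Gr (inr k0.2) l (coords p)).
    exact: frac.
  rewrite mulr_sumr; apply: eq_bigr => l _; rewrite grad_fraction //.
  exact: frac1.
pose near_p0 x : Prop :=
    [/\ forall b n, `|(D x)^-1 * F b n x - (D x0)^-1 * F b n x0| < 1,
        forall b l, `|(D x)^-1 * Gr b l x - (D x0)^-1 * Gr b l x0| < 1,
        forall n k, `|(D x * D x)^-1 * F1 n k x - (D x0 * D x0)^-1 * F1 n k x0| < eta &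
        `|(D x * D x * (D x * D x))^-1 * F2 x -
          (D x0 * D x0 * (D x0 * D x0))^-1 * F2 x0| < eta].
have near_all : \forall x \near box x0, near_p0 x.
  have pDD : polyfun (fun x => D x * D x) by exact: polyfunM.
  have DD0 : D x0 * D x0 != 0 by rewrite mulf_neq0.
  have nA : \forall x \near box x0, forall b n,
      `|(D x)^-1 * F b n x - (D x0)^-1 * F b n x0| < 1.
    apply: filter_forall => b; apply: filter_forall => n.
    exact: (ratfun_near (pF b n) pD D0 ltr01).
  have nB : \forall x \near box x0, forall b l,
      `|(D x)^-1 * Gr b l x - (D x0)^-1 * Gr b l x0| < 1.
    apply: filter_forall => b; apply: filter_forall => l.
    exact: (ratfun_near (pG b l) pD D0 ltr01).
  have nC : \forall x \near box x0, forall n k,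
      `|(D x * D x)^-1 * F1 n k x - (D x0 * D x0)^-1 * F1 n k x0| < eta.
    apply: filter_forall => n; apply: filter_forall => k.
    exact: (ratfun_near (pF1 n k) pDD DD0 eta0).
  have nD : \forall x \near box x0, `|(D x * D x * (D x * D x))^-1 * F2 x -
          (D x0 * D x0 * (D x0 * D x0))^-1 * F2 x0| < eta.
    by apply: (ratfun_near pF2 (polyfunM pDD pDD) _ eta0); rewrite mulf_neq0.
  by apply: filter_app nD; apply: filter_app nC; apply: filter_app nB;
    apply: filterS nA => x.
have [e /= e0 close] := near_all.
have [p pp0 gp] := exists_generic p0 e0.
have up : anchormx cardB (anchors a p) \in unitmx by exact: generic_anchors.
have [nA nB nC nD] : near_p0 (coords p).
  by apply: close => -[u k]; exact: pp0.
have near_le (u v B : R) : `|u - v| < 1 -> `|v| + 1 <= B -> `|u| <= B.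
  move=> uv vB; apply: le_trans (vB); rewrite -[u](subrK v) addrC.
  by apply: le_trans (ler_normD _ _) _; rewrite lerD2l ltW.
have bdp : @bounded_bary R d i m V a d_gt0 M p.
  split=> [b n|b l].
    apply: near_le (M_bary b n).
    by rewrite !bary_fraction //; exact: nA.
  apply: near_le (M_grad b l).
  by rewrite !grad_fraction //; exact: nB.
have [||w [w1 ws sol]] := solve p bdp.
- by move=> n k; rewrite -first0 !first_frac // ltW.
- by rewrite /g !second_frac // ltW.
have d0 : det3 a d_gt0 k0 p w != 0.
  have dL := deltaL p w bdp w1.
  have : `|w k0 * det3_rest a d_gt0 k0 p w| <= 16^-1.
    rewrite normrM; apply: (@le_trans _ _ (`|w k0| * L)); first by rewrite ler_wpM2l.
    have := normr_ge0 (w k0); lra.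
  by rewrite /det3 ler_norml => /andP[? _]; rewrite gt_eqF //; lra.
have [eq2 eq3 eq23] := system_moves d0 sol.
move=> rigid.
have fp : framework p by apply: (framework_of_unit (e := fun k => inl (a (anchor cardB k)))).
pose q := moved_config a d_gt0 p (fun j k => w k0 * zeta k0 w j k)
  (fun z j => w k0 / det3 a d_gt0 k0 p w * num3 a d_gt0 k0 p w z j).
have fq : framework q by exact: (moved_config_framework up).
have eqq : equivalent H p q by exact: (moved_config_equivalent up eq2 eq3 eq23).
have move20 := congruent_move2 up (rigid p fp gp q fq eqq).
(* Otherwise zeta would be the matrix of a quadric through X2 + X3. *)
have s0 : w k0 != 0.
  apply/negP => /eqP s0.
  have z0 : zeta k0 w 0 k0.2 = 0.
    apply: (generic_quadric_eq0 a_inj cardN gp (cardB := cardB) (c := zeta k0 w)) => n.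
    have := sol n; rewrite s0 mul0r addr0 first_orderE => /eqP.
    rewrite mulf_eq0 pnatr_eq0 /= => /eqP e4; rewrite -[RHS]e4.
    by do 2!apply: eq_bigr => ? _; rewrite mulrA [_ * zeta _ _ _ _]mulrC.
  by move: z0; rewrite /zeta /k0 eqxx => /eqP; rewrite oner_eq0.
pose c j := w k0 * zeta k0 w j k0.2.
have c_y y : \sum_j affine (end_beta a d_gt0 p j) (p (inr (inl y))) * c j = 0.
  pose e' := anchors a p (inr k0.2) - anchors a p (inl 0).
  have E : dot e' (move2 a d_gt0 p (fun j k => w k0 * zeta k0 w j k) y) = 0.
    by rewrite move20 dotC dot0l.
  have grad_e k : dot e' (gradient (end_gamma a d_gt0 p k)) = (k == k0.2)%:R.
    by rewrite -affineB !(bary_anchor up) subr0.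
  rewrite -[RHS]E /move2 dot_sumr (bigD1 k0.2) //= [X in _ = _ + X]big1.
    by rewrite addr0 dotZr grad_e eqxx mulr1.
  by move=> k /negbTE kk; rewrite dotZr grad_e kk mulr0.
(* If X2 does not move, an affine function vanishes on X4 + X2. *)
have f0 : \sum_j c j *: end_beta a d_gt0 p j = 0.
  apply: (@generic_affine_eq0 R d U p (sideB m a @: [set: 'I_(d - 1) + 'I_i])%SET) => //.
    rewrite card_imset; last exact: sideB_inj.
    by rewrite cardsT card_sum !card_ord.
  move=> u /imsetP[[k|y] _ ->]; rewrite affine_sumf /=.
    by rewrite big1 // => j _; rewrite affineZf (bary_anchor up (inl j) (inr k)) mulr0.
  by rewrite -[RHS](c_y y); apply: eq_bigr => j _; rewrite affineZf mulrC.
have := affine0f (anchors a p (inl 0)); rewrite -f0 affine_sumf sum_ord2 !affineZf.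
rewrite !(bary_anchor up) eqxx mulr1 mulr0 addr0 /c /zeta /k0 eqxx mulr1.
by move=> /eqP; rewrite (negbTE s0).
Qed.

End NotGloballyRigid.

(** * The attachment theorem *)

Lemma attachment_not_complete (d i m : nat) (V : finType) (G : sgraph V)
    (a : 'I_2 + 'I_(d - 1) -> V) :
  (2 < i)%N -> ~ graph_complete (@attachment 2 i m (d - 1) V G a).
Proof.
move=> i_gt2 complete.
have i_gt0 : (0 < i)%N by lia.
have i_gt1 : (1 < i)%N by lia.
pose y1 : 'I_i := Ordinal i_gt0; pose y2 : 'I_i := Ordinal i_gt1.
have := @complete (inr (inl y1)) (inr (inl y2)) isT.
move=> /attach_adjP[[? [? [_ ? _]]] //|[t [t' [_ [[]|[]]]]]].
  by case: t.
by move=> _; case: t.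
Qed.

Local Close Scope ring_scope.
Local Close Scope classical_set_scope.

Theorem theorem7p2 (R : realType) (d i : nat) (V : finType) (G : sgraph V)
    (a : 'I_2 + 'I_(d - 1) -> V) :
  2 < i -> i < d - 1 ->
  generically_redundantly_rigid R d G ->
  k_connected d.+1 G ->
  injective a ->
  generically_almost_globally_rigid R d
    (@attachment 2 i (2 * d - 2 - i) (d - 1) V G a).
Proof.
move=> i_gt2 i_ltd rrG G_conn a_inj.
have im : (i + (2 * d - 2 - i) = 2 * (d - 1))%N by lia.
have G_complete : #|V| = (1 + d)%N -> graph_complete G.
  by move=> cardV; apply: (rigid_simplex_complete _ cardV rrG.1); lia.
split.
- exact: attachment_not_complete.
- exact: attachment_connected.
- exact: attachment_redundantly_rigid.
- exact: attachment_not_globally_rigid.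
Qed.
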